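(* Let $\mathcal R$ be a unital ring and let $M$ be any right $\mathcal R$-module. Let $\overline{\mathcal X}^*$ be the commutative monoid of colours of nonempty pp-sets of $M$ and let $\mathcal J$ be the invariants ideal of the monoid ring $\mathbb Z[\overline{\mathcal X}^*]$. Then there is a ring isomorphism $$K_0(M)\cong\mathbb Z[\overline{\mathcal X}^*]/\mathcal J .$$
   Context: **Definable sets and pp-sets.** A right $\mathcal R$-module $M$ is viewed as a first order structure in the language $\langle 0,+,-,m_r: r\in\mathcal R\rangle$, where $m_r$ is interpreted as right multiplication by $r$. ''Definable'' means definable with parameters from $M$. A pp-formula is a formula equivalent to one of the form $\exists y_1\dots\exists y_m\bigwedge_{i=1}^t\left(\sum_j x_jr_{ij}+\sum_k y_ks_{ik}+c_i=0\right)$ with $r_{ij},s_{ik}\in\mathcal R$ and parameters $c_i\in M$. A pp-set is a subset of some $M^n$ ($n\ge1$) defined by a pp-formula; it is either empty or a coset of a subgroup of $M^n$ defined by a parameter-free pp-formula. For a nonempty pp-set $P$ let $P^\circ:=P-p$ ($p\in P$ arbitrary) be this subgroup. $\mathcal L_n$ is the set of all pp-subsets of $M^n$ and $\overline{\mathcal L}^*$ is the collection of all nonempty pp-sets in all $\mathcal L_n$, $n\geq 1$. **Grothendieck ring.** Two definable sets $A\subseteq M^n$, $B\subseteq M^m$ are definably isomorphic if there is a bijection $A\to B$ with definable graph; $[A]$ denotes the equivalence class. The set $\widetilde{\mathrm{Def}}(M)$ of all classes is a commutative semiring with $0=[\emptyset]$, $1=[\text{singleton}]$, $[A]+[B]=[A'\sqcup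 B']$ for disjoint $A'\in[A]$, $B'\in[B]$, and $[A]\cdot[B]=[A\times B]$. $K_0(M)$ is the Grothendieck ring of this semiring, i.e. the ring with the universal semiring homomorphism from $\widetilde{\mathrm{Def}}(M)$ to a commutative ring. **Colours.** For $P\in\overline{\mathcal L}^*$ the colour $[[P]]$ is the set of all $Q\in\overline{\mathcal L}^*$ for which there is a bijection $Q\to P$ whose graph is a pp-set. $\overline{\mathcal X}^*$ is the set of all colours of nonempty pp-sets; it is a commutative monoid under $[[A]]\star[[B]]:=[[A\times B]]$ with identity the colour $\mathfrak U$ of singletons. For a colour $\mathfrak A$, $\delta_{\mathfrak A}$ denotes the corresponding basis element of $\mathbb Z[\overline{\mathcal X}^*]$. **Invariants ideal.** For nonempty pp-sets $P,Q\in\mathcal L_n$ put $[P:Q]:=[P^\circ:P^\circ\cap Q^\circ]$. The invariants ideal $\mathcal J\subseteq\mathbb Z[\overline{\mathcal X}^*]$ is the ideal generated by all elements $\delta_{[[P]]}-[P:Q]\,\delta_{[[Q]]}$ where $P\supseteq Q$ are nonempty pp-sets in the same $\mathcal L_n$ (some $n\ge1$) with $[P:Q]<\infty$. *)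

(* Defs.v *)
From HB Require Import structures.
From mathcomp Require Import all_boot all_order all_algebra.
From mathcomp Require Import boolp classical_sets functions cardinality.
From mathcomp Require Import finmap.
From mathcomp Require Import monalg.

Set Implicit Arguments.
Unset Strict Implicit.
Unset Printing Implicit Defensive.
Import GRing.Theory.
Local Open Scope classical_set_scope.
Local Open Scope ring_scope.
Local Open Scope quotient_scope.

Section IdealQuotient.
Variables (A : comPzRingType) (G : set A).

Definition ideal_span : set A :=
  [set x | exists s : seq (A * A),
     (forall p, p \in s -> G p.2) /\ x = \sum_(p <- s) p.1 * p.2].

Definition ideal_span_pred : {pred A} := fun x => `[< ideal_span x >].

Lemma ideal_span0 : ideal_span 0.
Proof. by exists [::]; split=> //; rewrite big_nil. Qed.

Lemma ideal_spanD x y : ideal_span x -> ideal_span y -> ideal_span (x + y).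
Proof.
move=> [s [sG ->]] [t [tG ->]]; exists (s ++ t); split; last by rewrite big_cat.
by move=> p; rewrite mem_cat => /orP[/sG|/tG].
Qed.

Lemma ideal_spanM a x : ideal_span x -> ideal_span (a * x).
Proof.
move=> [s [sG ->]]; exists [seq (a * p.1, p.2) | p <- s]; split.
  by move=> _ /mapP[p /sG pG ->].
by rewrite big_map mulr_sumr; apply: eq_bigr => p _; rewrite mulrA.
Qed.

Lemma mem_ideal_span x : G x -> ideal_span x.
Proof.
move=> Gx; exists [:: (1, x)]; split; last by rewrite big_seq1 mul1r.
by move=> p; rewrite inE => /eqP ->.
Qed.

Lemma ideal_span_zmod_closed : zmod_closed ideal_span_pred.
Proof.
split=> [|x y /asboolP Ix /asboolP Iy]; apply/asboolP; first exact: ideal_span0.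
by apply: ideal_spanD => //; rewrite -mulN1r; apply: ideal_spanM.
Qed.

HB.instance Definition _ :=
  GRing.isZmodClosed.Build A ideal_span_pred ideal_span_zmod_closed.

(* The quotient A / (G).  The library only equips {ideal_quot I} with a ring
   structure when I is known to be proper, hence the instance below. *)
Definition quot_span : Type := 
  {ideal_quot GRing.ZmodClosed.clone A ideal_span_pred _}.
HB.instance Definition _ := GRing.Zmodule.on quot_span.

Definition quot_pi (x : A) : quot_span := \pi x.
Let rp (x : quot_span) : A := repr x.

Lemma quot_piP x y : quot_pi x = quot_pi y <-> ideal_span (x - y).
Proof.
rewrite /quot_pi; split=> [/eqP|H]; last apply/eqP;
  rewrite -Quotient.idealrBE; [by move/asboolP | exact/asboolP].
Qed.

Let rpK x : quot_pi (rp x) = x. Proof. exact: reprK. Qed.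

Lemma quot_piB : {morph quot_pi : x y / x - y}.
Proof. by move=> x y; rewrite /quot_pi raddfB. Qed.

Definition quot_mul (x y : quot_span) : quot_span := quot_pi (rp x * rp y).

Lemma quot_piM x y : quot_pi (x * y) = quot_mul (quot_pi x) (quot_pi y).
Proof.
apply/quot_piP.
have -> : x * y - rp (quot_pi x) * rp (quot_pi y)
  = y * (x - rp (quot_pi x)) + rp (quot_pi x) * (y - rp (quot_pi y)).
  by rewrite !mulrBr addrA (mulrC y x) (mulrC y) subrK.
by apply: ideal_spanD; apply: ideal_spanM; apply/quot_piP; rewrite rpK.
Qed.

Lemma quot_piD : {morph quot_pi : x y / x + y}.
Proof. by move=> x y; rewrite /quot_pi raddfD. Qed.

Lemma quot_mulA : associative quot_mul.
Proof. by move=> x y z; rewrite -[x]rpK -[y]rpK -[z]rpK -!quot_piM mulrA. Qed.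
Lemma quot_mulC : commutative quot_mul.
Proof. by move=> x y; rewrite -[x]rpK -[y]rpK -!quot_piM mulrC. Qed.
Lemma quot_mul1 : left_id (quot_pi 1) quot_mul.
Proof. by move=> x; rewrite -[x]rpK -quot_piM mul1r. Qed.
Lemma quot_mulDl : left_distributive quot_mul +%R.
Proof.
move=> x y z; rewrite -[x]rpK -[y]rpK -[z]rpK.
by rewrite -quot_piD -!quot_piM -quot_piD mulrDl.
Qed.

HB.instance Definition _ := GRing.Zmodule_isComPzRing.Build quot_span
  quot_mulA quot_mulC quot_mul1 quot_mulDl.

HB.instance Definition _ :=
  GRing.isZmodMorphism.Build A quot_span quot_pi quot_piB.
HB.instance Definition _ :=
  GRing.isMonoidMorphism.Build A quot_span quot_pi (erefl, quot_piM).

Lemma quot_pi_surj (x : quot_span) : exists a, quot_pi a = x.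
Proof. by exists (rp x); rewrite rpK. Qed.

End IdealQuotient.

Section Language.
Variables (R : pzRingType) (M : lmodType R^c).

(* A right R-module is a left module over the converse ring R^c; rscale x r is
   the right multiplication x r. *)
Definition rscale (x : M) (r : R) : M := (r : R^c) *: x.

(* Terms and formulas with free variables indexed by [V] and parameters in M;
   under [FEx] the bound variable is [None]. *)
Inductive term (V : Type) : Type :=
| TVar of V | TPar of M | TZero | TOpp of term V
| TAdd of term V & term V | TMul of term V & R.

Inductive formula (V : Type) : Type :=
| FEq of term V & term V | FNot of formula V
| FAnd of formula V & formula V | FEx of formula (option V).

Fixpoint eval (V : Type) (e : V -> M) (t : term V) : M :=
  match t with
  | TVar v => e v
  | TPar a => a
  | TZero => 0
  | TOpp t => - eval e t
  | TAdd t u => eval e t + eval e u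
  | TMul t r => rscale (eval e t) r
  end.

Definition ext (V : Type) (e : V -> M) (y : M) (o : option V) : M := oapp e y o.

Fixpoint holds (V : Type) (f : formula V) : (V -> M) -> Prop :=
  match f with
  | FEq t u => fun e => eval e t = eval e u
  | FNot f => fun e => ~ holds f e
  | FAnd f g => fun e => holds f e /\ holds g e
  | FEx f => fun e => exists y, holds f (ext e y)
  end.

Definition definable n (A : set 'rV[M]_n) : Prop :=
  exists f : formula 'I_n, A = [set x | holds f (fun i => x 0 i)].

Definition pp n (A : set 'rV[M]_n) : Prop :=
  exists m t (r : 'M[R]_(t, n)) (s : 'M[R]_(t, m)) (c : 'rV[M]_t),
    A = [set x | exists y : 'rV[M]_m, forall i,
           \sum_j rscale (x 0 j) (r i j) + \sum_k rscale (y 0 k) (s i k)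
             + c 0 i = 0].

Definition prod_set m n (A : set 'rV[M]_m) (B : set 'rV[M]_n)
    : set 'rV[M]_(m + n) :=
  [set z | A (lsubmx z) /\ B (rsubmx z)].

Definition graph_on m n (A : set 'rV[M]_m) (f : 'rV[M]_m -> 'rV[M]_n)
    : set 'rV[M]_(m + n) :=
  [set row_mx x (f x) | x in A].

(* A bijection from A to B whose graph belongs to the class C. *)
Definition iso_via (C : forall k, set 'rV[M]_k -> Prop) m n
    (A : set 'rV[M]_m) (B : set 'rV[M]_n) : Prop :=
  exists f : 'rV[M]_m -> 'rV[M]_n, set_bij A B f /\ C (m + n)%N (graph_on A f).

End Language.

(* C will be either [definable] or [pp]. *)
Section IsoVia.
Variables (R : pzRingType) (M : lmodType R^c).
Variable C : forall n, set 'rV[M]_n -> Prop.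
Hypothesis CI : forall n (A B : set 'rV[M]_n), C A -> C B -> C (A `&` B).
Hypothesis CT : forall n, C (@setT 'rV[M]_n).
Hypothesis Csub : forall m n (s : 'I_m -> 'I_n) (A : set 'rV[M]_m),
  C A -> C [set x : 'rV[M]_n | A (\row_i x 0 (s i))].
Hypothesis Cdiag : forall n (i j : 'I_n), C [set x : 'rV[M]_n | x 0 i = x 0 j].
Hypothesis Cex : forall m n (A : set 'rV[M]_(m + n)),
  C A -> C [set x | exists y, A (row_mx x y)].
Hypothesis C1 : forall n (p : 'rV[M]_n), C [set p].

Let Ceq n (A B : set 'rV[M]_n) : C A -> A = B -> C B.
Proof. by move=> CA <-. Qed.

Let Clsub m n (A : set 'rV[M]_m) : C A -> C [set z : 'rV[M]_(m + n) | A (lsubmx z)].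
Proof.
move=> /(Csub (lshift n)) /Ceq; apply; apply/funext => z /=.
by congr A; apply/rowP => i; rewrite !mxE.
Qed.

Let Crsub m n (A : set 'rV[M]_n) : C A -> C [set z : 'rV[M]_(m + n) | A (rsubmx z)].
Proof.
move=> /(Csub (@rshift m n)) /Ceq; apply; apply/funext => z /=.
by congr A; apply/rowP => i; rewrite !mxE.
Qed.

Lemma prod_via m n (A : set 'rV[M]_m) (B : set 'rV[M]_n) :
  C A -> C B -> C (prod_set A B).
Proof. by move=> CA CB; apply: CI; [apply: Clsub|apply: Crsub]. Qed.

Lemma iso_relP m n (A : set 'rV[M]_m) (B : set 'rV[M]_n) :
  iso_via C A B <-> exists F : set 'rV[M]_(m + n), C F /\
   [/\ forall x y, F (row_mx x y) -> A x /\ B y,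
       forall x, A x -> exists y, F (row_mx x y),
       forall y, B y -> exists x, F (row_mx x y),
       forall x y y', F (row_mx x y) -> F (row_mx x y') -> y = y' &
       forall x x' y, F (row_mx x y) -> F (row_mx x' y) -> x = x'].
Proof.
split=> [[f [[fun_f inj_f surj_f] Cf]]|[F [CF [dF totF surF funF injF]]]].
  have gE x y : graph_on A f (row_mx x y) <-> A x /\ y = f x.
    split=> [[x' Ax' /eq_row_mx[<- <-]]//|[Ax ->]]; by exists x.
  exists (graph_on A f); split=> //; split.
  - by move=> x y /gE[Ax ->]; split=> //; apply: fun_f.
  - by move=> x Ax; exists (f x); apply/gE.
  - by move=> y /surj_f[x Ax <-]; exists x; apply/gE.
  - by move=> x y y' /gE[_ ->] /gE[_ ->].
  - by move=> x x' y /gE[Ax ->] /gE[Ax' e]; apply: inj_f; rewrite ?in_setE.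
pose f x := xget 0 [set y | F (row_mx x y)].
have fP x : A x -> F (row_mx x (f x)).
  by move=> /totF[y Fy]; rewrite /f; case: xgetP => [z ->|/(_ y)].
exists f; split; last first.
  apply: (Ceq CF); apply/seteqP; split=> [z Fz|_ [x Ax <-]]; last exact: fP.
  rewrite -[z]hsubmxK in Fz *; have [Ax _] := dF _ _ Fz.
  by exists (lsubmx z) => //; congr row_mx; apply: funF Fz; apply: fP.
split.
- by move=> x /fP /dF[].
- by move=> x x'; rewrite !in_setE => /fP Fx /fP Fx' e; rewrite -e in Fx'; apply: injF Fx Fx'.
- move=> y /surF[x Fx]; have [Ax _] := dF _ _ Fx; exists x => //.
  by apply: funF Fx; apply: fP.
Qed.

Lemma iso_coord m n (s : 'I_n -> 'I_m) (A : set 'rV[M]_m) (B : set 'rV[M]_n) :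
  C A -> set_bij A B (fun x => \row_i x 0 (s i)) -> iso_via C A B.
Proof.
move=> CA bij; eexists; split; first exact: bij.
have Call (k : nat) (p : nat -> set 'rV[M]_k) (l : nat) :
    (forall i, C (p i)) -> C [set z | forall i, (i < l)%N -> p i z].
  move=> Cp; elim: l => [|l IH].
    by apply: (Ceq (CT k)); apply/seteqP; split=> // z _ i.
  apply: (Ceq (CI IH (Cp l))); apply/seteqP; split=> z /=.
    move=> [H Hl] i; rewrite ltnS leq_eqVlt => /orP[/eqP->//|]; exact: H.
  by move=> H; split=> [i il|]; apply: H; rewrite // ltnW.
pose p i : set 'rV[M]_(m + n) := if insub i is Some j then
   [set z | z 0 (rshift m j) = z 0 (lshift n (s j))] else setT.
have Cp i : C (p i) by rewrite /p; case: insub => [j|]; [exact: Cdiag|exact: CT].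
apply: (Ceq (CI (Clsub n CA) (Call _ p n Cp))); apply/seteqP; split=> z /=.
  move=> [Az H]; exists (lsubmx z) => //; rewrite -[RHS]hsubmxK; congr row_mx.
  apply/rowP => i; rewrite !mxE.
  by have := H i (ltn_ord i); rewrite /p valK.
move=> [x Ax <-]; rewrite row_mxKl; split=> // i il.
by rewrite /p insubT /= row_mxEr row_mxEl mxE.
Qed.

Lemma iso_refl n (A : set 'rV[M]_n) : C A -> iso_via C A A.
Proof.
move=> CA; apply: (@iso_coord _ _ id) => //.
have E (x : 'rV[M]_n) : \row_i x 0 i = x by apply/rowP => i; rewrite mxE.
by split=> [x|x y|x]; rewrite /= ?E // => Ax; exists x.
Qed.

Lemma iso_sym m n (A : set 'rV[M]_m) (B : set 'rV[M]_n) :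
  iso_via C A B -> iso_via C B A.
Proof.
move=> /iso_relP[F [CF [dF totF surF funF injF]]]; apply/iso_relP.
pose s (i : 'I_(m + n)) : 'I_(n + m) :=
  match fintype.split i with inl j => rshift n j | inr j => lshift m j end.
have sE (x : 'rV[M]_n) (y : 'rV[M]_m) :
    \row_i (row_mx x y) 0 (s i) = row_mx y x.
  apply/rowP => i; rewrite !mxE /s; case: (fintype.split i) => j.
    by rewrite (unsplitK (inr _ j)).
  by rewrite (unsplitK (inl _ j)).
exists [set z | F (\row_i z 0 (s i))]; split; first exact: Csub.
split=> /=.
- by move=> x y; rewrite sE => /dF[].
- by move=> x /surF[y]; exists y; rewrite sE.
- by move=> x /totF[y]; exists y; rewrite sE.
- by move=> x y y'; rewrite !sE; apply: injF.
- by move=> x y y'; rewrite !sE; apply: funF.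
Qed.

Lemma iso_trans l m n (A : set 'rV[M]_l) (B : set 'rV[M]_m) (D : set 'rV[M]_n) :
  iso_via C A B -> iso_via C B D -> iso_via C A D.
Proof.
move=> /iso_relP[F [CF [dF totF surF funF injF]]].
move=> /iso_relP[G [CG [dG totG surG funG injG]]]; apply/iso_relP.
pose s (i : 'I_(l + m)) : 'I_(l + n + m) :=
  match fintype.split i with inl j => lshift m (lshift n j) | inr j => rshift _ j end.
pose t (i : 'I_(m + n)) : 'I_(l + n + m) :=
  match fintype.split i with inl j => rshift _ j | inr j => lshift m (rshift l j) end.
have sE x z y : \row_i (row_mx (row_mx x z) y : 'rV[M]_(l + n + m)) 0 (s i)
    = row_mx x y.
  apply/rowP => i; rewrite [LHS]mxE [RHS]mxE /s; case: (fintype.split i) => j.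
    by rewrite !row_mxEl.
  by rewrite row_mxEr.
have tE x z y : \row_i (row_mx (row_mx x z) y : 'rV[M]_(l + n + m)) 0 (t i)
    = row_mx y z.
  apply/rowP => i; rewrite [LHS]mxE [RHS]mxE /t; case: (fintype.split i) => j.
    by rewrite row_mxEr.
  by rewrite row_mxEl row_mxEr.
exists [set w | exists y, F (\row_i (row_mx w y) 0 (s i)) /\
                          G (\row_i (row_mx w y) 0 (t i))].
split.
  apply: (@Cex _ _ [set w | F (\row_i w 0 (s i)) /\ G (\row_i w 0 (t i))]).
  by apply: CI; apply: Csub.
have E x z : (exists y, F (\row_i (row_mx (row_mx x z) y) 0 (s i)) /\
                        G (\row_i (row_mx (row_mx x z) y) 0 (t i))) <->
             exists y, F (row_mx x y) /\ G (row_mx y z).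
  by split=> -[y]; rewrite ?sE ?tE => H; exists y; rewrite ?sE ?tE.
split=> /=.
- by move=> x z /E[y [/dF[? _] /dG[_ ?]]].
- move=> x /totF[y Fxy]; have [_ /totG[z Gyz]] := dF _ _ Fxy.
  by exists z; apply/E; exists y.
- move=> z /surG[y Gyz]; have [/surF[x Fxy] _] := dG _ _ Gyz.
  by exists x; apply/E; exists y.
- move=> x z z' /E[y [Fy Gy]] /E[y' [Fy' Gy']].
  by rewrite -(funF _ _ _ Fy Fy') in Gy'; apply: funG Gy Gy'.
- move=> x x' z /E[y [Fy Gy]] /E[y' [Fy' Gy']].
  by rewrite -(injG _ _ _ Gy Gy') in Fy'; apply: injF Fy Fy'.
Qed.

Lemma iso_prod m n m' n' (A : set 'rV[M]_m) (B : set 'rV[M]_n)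
    (A' : set 'rV[M]_m') (B' : set 'rV[M]_n') :
  iso_via C A A' -> iso_via C B B' ->
  iso_via C (prod_set A B) (prod_set A' B').
Proof.
move=> /iso_relP[F [CF [dF totF surF funF injF]]].
move=> /iso_relP[G [CG [dG totG surG funG injG]]]; apply/iso_relP.
pose s (i : 'I_(m + m')) : 'I_(m + n + (m' + n')) :=
  match fintype.split i with inl j => lshift _ (lshift n j)
                   | inr j => rshift _ (lshift n' j) end.
pose t (i : 'I_(n + n')) : 'I_(m + n + (m' + n')) :=
  match fintype.split i with inl j => lshift _ (rshift m j)
                   | inr j => rshift _ (rshift m' j) end.
have sE x y : \row_i (row_mx x y : 'rV[M]_(m + n + (m' + n'))) 0 (s i)
    = row_mx (lsubmx x) (lsubmx y).
  apply/rowP => i; rewrite [LHS]mxE [RHS]mxE /s; case: (fintype.split i) => j.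
    by rewrite row_mxEl mxE.
  by rewrite row_mxEr mxE.
have tE x y : \row_i (row_mx x y : 'rV[M]_(m + n + (m' + n'))) 0 (t i)
    = row_mx (rsubmx x) (rsubmx y).
  apply/rowP => i; rewrite [LHS]mxE [RHS]mxE /t; case: (fintype.split i) => j.
    by rewrite row_mxEl mxE.
  by rewrite row_mxEr mxE.
exists [set w | F (\row_i w 0 (s i)) /\ G (\row_i w 0 (t i))].
split; first by apply: CI; apply: Csub.
split=> /=.
- by move=> x y; rewrite sE tE => -[/dF[? ?] /dG[? ?]].
- move=> x [/totF[y Fy] /totG[z Gz]]; exists (row_mx y z).
  by rewrite sE tE row_mxKl row_mxKr.
- move=> x [/surF[y Fy] /surG[z Gz]]; exists (row_mx y z).
  by rewrite sE tE row_mxKl row_mxKr.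
- move=> x y y'; rewrite !sE !tE => -[Fy Gy] [Fy' Gy'].
  by rewrite -[y]hsubmxK -[y']hsubmxK (funF _ _ _ Fy Fy') (funG _ _ _ Gy Gy').
- move=> x y y'; rewrite !sE !tE => -[Fy Gy] [Fy' Gy'].
  by rewrite -[x]hsubmxK -[y]hsubmxK (injF _ _ _ Fy Fy') (injG _ _ _ Gy Gy').
Qed.

Lemma iso_point m n (p : 'rV[M]_m) (q : 'rV[M]_n) : iso_via C [set p] [set q].
Proof.
apply/iso_relP; exists [set row_mx p q]; split=> //; split=> /=.
- by move=> x y /eq_row_mx[].
- by move=> x ->; exists q.
- by move=> x ->; exists p.
- by move=> x y y' /eq_row_mx[_ ->] /eq_row_mx[].
- by move=> x y y' /eq_row_mx[-> _] /eq_row_mx[].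
Qed.

Lemma iso_empty m n : C (@set0 'rV[M]_(m + n)) ->
  iso_via C (@set0 'rV[M]_m) (@set0 'rV[M]_n).
Proof. by move=> C0; apply/iso_relP; exists set0. Qed.

Lemma iso_prodC m n (A : set 'rV[M]_m) (B : set 'rV[M]_n) : C A -> C B ->
  iso_via C (prod_set A B) (prod_set B A).
Proof.
move=> CA CB.
pose s (i : 'I_(n + m)) : 'I_(m + n) :=
  match fintype.split i with inl j => rshift m j | inr j => lshift n j end.
have sE (x : 'rV[M]_(m + n)) :
    \row_i x 0 (s i) = row_mx (rsubmx x) (lsubmx x).
  by apply/rowP => i; rewrite !mxE /s; case: (fintype.split i) => j; rewrite mxE.
apply: (@iso_coord _ _ s); first exact: prod_via.
split=> [x [Ax Bx]|x y _ _|x [Bx Ax]].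
- by rewrite sE; split; rewrite ?row_mxKl ?row_mxKr.
- by rewrite !sE => /eq_row_mx[e1 e2]; rewrite -[x]hsubmxK -[y]hsubmxK e1 e2.
exists (row_mx (rsubmx x) (lsubmx x)).
  by split; rewrite ?row_mxKl ?row_mxKr.
by rewrite sE row_mxKl row_mxKr hsubmxK.
Qed.

Lemma iso_prodA l m n (A : set 'rV[M]_l) (B : set 'rV[M]_m)
    (D : set 'rV[M]_n) : C A -> C B -> C D ->
  iso_via C (prod_set A (prod_set B D)) (prod_set (prod_set A B) D).
Proof.
move=> CA CB CD.
pose s (i : 'I_(l + m + n)) : 'I_(l + (m + n)) :=
  match fintype.split i with
  | inl j => match fintype.split j with inl k => lshift _ k
                              | inr k => rshift l (lshift n k) end
  | inr j => rshift l (rshift m j) end.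
have sE (x : 'rV[M]_(l + (m + n))) :
    \row_i x 0 (s i)
    = row_mx (row_mx (lsubmx x) (lsubmx (rsubmx x))) (rsubmx (rsubmx x)).
  apply/rowP => i; rewrite [LHS]mxE [RHS]mxE /s; case: (fintype.split i) => j.
    by rewrite mxE; case: (fintype.split j) => k; rewrite !mxE.
  by rewrite !mxE.
apply: (@iso_coord _ _ s); first by apply: prod_via => //; apply: prod_via.
split=> [x [Ax [Bx Dx]]|x y _ _|x [[Ax Bx] Dx]].
- by rewrite sE; split; rewrite ?row_mxKr // row_mxKl; split; rewrite ?row_mxKl ?row_mxKr.
- rewrite !sE => /eq_row_mx[/eq_row_mx[e1 e2] e3].
  by rewrite -[x]hsubmxK -[y]hsubmxK -[rsubmx x]hsubmxK -[rsubmx y]hsubmxK e1 e2 e3.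
exists (row_mx (lsubmx (lsubmx x)) (row_mx (rsubmx (lsubmx x)) (rsubmx x))).
  by split; rewrite ?row_mxKl // row_mxKr; split; rewrite ?row_mxKl ?row_mxKr.
by rewrite sE !row_mxKl !row_mxKr row_mxKl !hsubmxK.
Qed.

Lemma iso_prod1 m n (A : set 'rV[M]_n) (p : 'rV[M]_m) : C A ->
  iso_via C (prod_set [set p] A) A.
Proof.
move=> CA.
have sE (x : 'rV[M]_(m + n)) : \row_i x 0 (rshift m i) = rsubmx x.
  by apply/rowP => i; rewrite !mxE.
apply: (@iso_coord _ _ (@rshift m n)); first exact: prod_via.
split=> [x [_ ?]|x y|x Ax]; rewrite ?sE //.
  rewrite !in_setE => -[xp _] [yp _] e.
  by rewrite -[x]hsubmxK -[y]hsubmxK e xp yp.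
exists (row_mx p x); first by split; rewrite ?row_mxKl ?row_mxKr.
by rewrite sE row_mxKr.
Qed.

Lemma iso_point_prod l m n (A : set 'rV[M]_m) (B : set 'rV[M]_n) (p : 'rV[M]_l) :
  iso_via C (prod_set A B) [set p] ->
  exists a b, A = [set a] /\ B = [set b].
Proof.
move=> [f [[fun_f inj_f surj_f] _]].
have [z [Az Bz] fz] : exists2 z, prod_set A B z & f z = p by exact: surj_f.
exists (lsubmx z), (rsubmx z); split; apply/seteqP; split=> [x Ax|_ ->]//.
  have Px : prod_set A B (row_mx x (rsubmx z)) by split; rewrite ?row_mxKl ?row_mxKr.
  have /(congr1 lsubmx) : row_mx x (rsubmx z) = z.
    by apply: inj_f; rewrite ?in_setE //; rewrite fz; apply: fun_f Px.
  by rewrite row_mxKl.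
have Px : prod_set A B (row_mx (lsubmx z) x) by split; rewrite ?row_mxKl ?row_mxKr.
have /(congr1 rsubmx) : row_mx (lsubmx z) x = z.
  by apply: inj_f; rewrite ?in_setE //; rewrite fz; apply: fun_f Px.
by rewrite row_mxKr.
Qed.

End IsoVia.

Section Definable.
Variables (R : pzRingType) (M : lmodType R^c).

Fixpoint term_map (V W : Type) (s : V -> W) (t : term M V) : term M W :=
  match t with
  | TVar v => TVar M (s v)
  | TPar a => TPar W a
  | TZero => TZero M W
  | TOpp t => TOpp (term_map s t)
  | TAdd t u => TAdd (term_map s t) (term_map s u)
  | TMul t r => TMul (term_map s t) r
  end.

Fixpoint formula_map (V W : Type) (s : V -> W) (f : formula M V) : formula M W :=
  match f with
  | FEq t u => FEq (term_map s t) (term_map s u)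
  | FNot f => FNot (formula_map s f)
  | FAnd f g => FAnd (formula_map s f) (formula_map s g)
  | FEx f => FEx (formula_map (omap s) f)
  end.

Lemma eval_map (V W : Type) (s : V -> W) t (e : W -> M) :
  eval e (term_map s t) = eval (e \o s) t.
Proof. by elim: t => //= [t ->|t -> u ->|t -> r]. Qed.

Lemma holds_map (V W : Type) (s : V -> W) f (e : W -> M) :
  holds (formula_map s f) e = holds f (e \o s).
Proof.
elim: f W s e => {V} [V t u|V f IH|V f IHf g IHg|V f IH] W s e /=.
- by rewrite !eval_map.
- by rewrite IH.
- by rewrite IHf IHg.
- congr (exists y, _); apply/funext => y; rewrite IH; congr holds.
  by apply/funext => -[].
Qed.

Lemma formula_exn n (V : Type) (f : formula M (V + 'I_n)) :
  exists g : formula M V, forall e, holds g e <->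
    exists y : 'I_n -> M, holds f (fun v => match v with inl v => e v | inr i => y i end).
Proof.
elim: n V f => [|n IH] V f.
  exists (formula_map (fun v : V + 'I_0 => match v with inl v => v
    | inr i => False_rect V (notF (ltn_ord i)) end) f) => e; rewrite holds_map.
  have E (y : 'I_0 -> M) : (fun v => match v with inl v => e v | inr i => y i end)
     = e \o (fun v : V + 'I_0 => match v with inl v => v
    | inr i => False_rect V (notF (ltn_ord i)) end).
    by apply/funext => -[//|[]].
  by split=> [H|[y]]; [exists (fun=> 0)|]; rewrite E.
pose s (v : V + 'I_n.+1) : option V + 'I_n := match v with
  | inl v => inl (Some v)
  | inr i => if unlift ord0 i is Some j then inr j else inl None end.
have [g gP] := IH _ (formula_map s f); exists (FEx g) => e /=; split.
  move=> [y0 /gP[y]]; rewrite holds_map => H.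
  exists (fun i => if unlift ord0 i is Some j then y j else y0).
  congr holds: H; apply/funext => -[v//|i] /=.
  by case: (unlift ord0 i).
move=> [y H]; exists (y ord0); apply/gP; exists (fun j => y (lift ord0 j)).
rewrite holds_map; congr holds: H; apply/funext => -[v//|i] /=.
by case: unliftP => [j|] ->.
Qed.

Lemma definableI n (A B : set 'rV[M]_n) :
  definable A -> definable B -> definable (A `&` B).
Proof. by move=> [f ->] [g ->]; exists (FAnd f g). Qed.

Lemma definableC n (A : set 'rV[M]_n) : definable A -> definable (~` A).
Proof. by move=> [f ->]; exists (FNot f). Qed.

Lemma definableU n (A B : set 'rV[M]_n) :
  definable A -> definable B -> definable (A `|` B).
Proof.
move=> dA dB; rewrite -[_ `|` _]setCK setCU.
by apply/definableC/definableI; apply: definableC.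
Qed.

Lemma definableT n : definable (@setT 'rV[M]_n).
Proof. by exists (FEq (TZero M _) (TZero M _)); apply/seteqP; split. Qed.

Lemma definable0 n : definable (@set0 'rV[M]_n).
Proof. by rewrite -setCT; apply/definableC/definableT. Qed.

Lemma definable_sub m n (s : 'I_m -> 'I_n) (A : set 'rV[M]_m) :
  definable A -> definable [set x : 'rV[M]_n | A (\row_i x 0 (s i))].
Proof.
move=> [f ->]; exists (formula_map s f); apply/funext => x /=.
by rewrite holds_map; congr holds; apply/funext => i; rewrite mxE.
Qed.

Lemma definable_diag n (i j : 'I_n) : definable [set x : 'rV[M]_n | x 0 i = x 0 j].
Proof. by exists (FEq (TVar M i) (TVar M j)). Qed.

Lemma definable_ex m n (A : set 'rV[M]_(m + n)) :
  definable A -> definable [set x | exists y, A (row_mx x y)].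
Proof.
move=> [f ->]; have [g gP] := formula_exn (formula_map (@fintype.split m n) f).
exists g; apply/seteqP; split=> x /=.
  move=> [y H]; apply/gP; exists (fun i => y 0 i).
  rewrite holds_map; congr holds: H; apply/funext => i /=.
  by rewrite mxE; case: fintype.split.
move=> /gP[y H]; exists (\row_i y i); rewrite holds_map in H.
congr holds: H; apply/funext => i /=.
by rewrite mxE; case: fintype.split => // j; rewrite mxE.
Qed.

Lemma definable1 n (p : 'rV[M]_n) : definable [set p].
Proof.
have H (s : seq 'I_n) : definable [set x : 'rV[M]_n | forall i, i \in s -> x 0 i = p 0 i].
  elim: s => [|i s IH].
    suff -> : [set x : 'rV[M]_n | forall i, i \in [::] -> x 0 i = p 0 i] = setT.
      exact: definableT.
    exact/seteqP.
  have di : definable [set x : 'rV[M]_n | x 0 i = p 0 i].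
    by exists (FEq (TVar M i) (TPar _ (p 0 i))).
  have := definableI di IH; congr definable; apply/seteqP; split=> x /=.
    by move=> [xi xs] j; rewrite inE => /orP[/eqP->//|/xs].
  move=> xs; split; first by apply: xs; rewrite mem_head.
  by move=> j js; apply: xs; rewrite inE js orbT.
have := H (enum 'I_n); congr definable; apply/seteqP; split=> x /=.
  by move=> xp; apply/rowP => i; apply: xp; rewrite mem_enum.
by move=> ->.
Qed.

End Definable.

Section PP.
Variables (R : pzRingType) (M : lmodType R^c).

Lemma rscale0 (x : M) : rscale x 0 = 0. Proof. exact: scale0r. Qed.
Lemma rscale1 (x : M) : rscale x 1 = x. Proof. exact: scale1r. Qed.
Lemma rscaleB (x : M) (r s : R) : rscale x (r - s) = rscale x r - rscale x s.
Proof. exact: scalerBl. Qed.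
Lemma rscale_sum (x : M) (I : finType) (P : pred I) (r : I -> R) :
  rscale x (\sum_(i | P i) r i) = \sum_(i | P i) rscale x (r i).
Proof. exact: scaler_suml. Qed.

Let sum_void (F : void -> M) : \sum_k F k = 0. Proof. by rewrite big1 => [|[]]. Qed.

Lemma sum_rscale_delta (I : finType) (x : I -> M) (i : I) :
  \sum_j rscale (x j) (i == j)%:R = x i.
Proof.
rewrite (bigD1 i) //= eqxx rscale1 big1 ?addr0 // => j ji.
by rewrite eq_sym (negbTE ji) rscale0.
Qed.

Definition pp_sys n (I J : finType) (r : I -> 'I_n -> R) (s : I -> J -> R)
    (c : I -> M) : set 'rV[M]_n :=
  [set x | exists y : J -> M, forall i,
     \sum_j rscale (x 0 j) (r i j) + \sum_k rscale (y k) (s i k) + c i = 0].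

Let ev (T : finType) (i : 'I_#|T|) : T := enum_val i.

Lemma pp_sysP n (I J : finType) (r : I -> 'I_n -> R) (s : I -> J -> R)
    (c : I -> M) : pp (pp_sys r s c).
Proof.
exists #|J|, #|I|, (\matrix_(i, j) r (ev i) j),
  (\matrix_(i, k) s (ev i) (ev k)), (\row_i c (ev i)).
have E (x : 'rV[M]_n) (y : J -> M) i :
  \sum_j rscale (x 0 j) ((\matrix_(i, j) r (ev i) j) i j) +
  \sum_k rscale (y (ev k)) ((\matrix_(i, k) s (ev i) (ev k)) i k)
   + (\row_i c (ev i)) 0 i =
  \sum_j rscale (x 0 j) (r (ev i) j) +
  \sum_k rscale (y k) (s (ev i) k) + c (ev i).
  congr (_ + _ + _); last by rewrite mxE.
    by apply: eq_bigr => j _; rewrite mxE.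
  apply: etrans (reindex (@enum_rank J) (onW_bij _ (@enum_rank_bij J))) _.
  by apply: eq_bigr => j _; rewrite mxE /ev enum_rankK.
apply/seteqP; split=> x [y H].
  exists (\row_k y (ev k)) => i; rewrite -[RHS](H (ev i)) -E.
  by congr (_ + _ + _); apply: eq_bigr => k _; rewrite [X in rscale X _]mxE.
exists (fun k => y 0 (enum_rank k)) => i.
have := E x (fun k => y 0 (enum_rank k)) (enum_rank i).
rewrite /ev enum_rankK => <-; rewrite -[RHS](H (enum_rank i)).
by congr (_ + _ + _); apply: eq_bigr => k _; rewrite /ev enum_valK.
Qed.

Lemma pp_sysE n (A : set 'rV[M]_n) : pp A ->
  exists I J r s c, A = @pp_sys n I J r s c.
Proof.
move=> [m [t [r [s [c ->]]]]].
exists 'I_t, 'I_m, (fun i j => r i j), (fun i j => s i j), (fun i => c 0 i).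
apply/seteqP; split=> x [y H]; first by exists (fun i => y 0 i).
exists (\row_i y i) => i; rewrite -[RHS](H i); congr (_ + _ + _).
by apply: eq_bigr => j _; rewrite mxE.
Qed.

Lemma ppI n (A B : set 'rV[M]_n) : pp A -> pp B -> pp (A `&` B).
Proof.
move=> /pp_sysE[I [J [r [s [c ->]]]]] /pp_sysE[I' [J' [r' [s' [c' ->]]]]].
pose r2 (i : I + I') := match i with inl i => r i | inr i => r' i end.
pose s2 (i : I + I') (j : J + J') := match i, j with
  | inl i, inl j => s i j | inr i, inr j => s' i j | _, _ => 0 end.
pose c2 (i : I + I') := match i with inl i => c i | inr i => c' i end.
suff -> : pp_sys r s c `&` pp_sys r' s' c' = pp_sys r2 s2 c2 by exact: pp_sysP.
have El (y : J + J' -> M) i :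
    \sum_k rscale (y k) (s2 (inl i) k) = \sum_k rscale (y (inl k)) (s i k).
  by rewrite big_sumType /= [X in _ + X]big1 ?addr0 // => k _; rewrite rscale0.
have Er (y : J + J' -> M) i :
    \sum_k rscale (y k) (s2 (inr i) k) = \sum_k rscale (y (inr k)) (s' i k).
  by rewrite big_sumType /= [X in X + _]big1 ?add0r // => k _; rewrite rscale0.
apply/seteqP; split=> x.
  move=> [[y H] [y' H']].
  exists (fun j => match j with inl j => y j | inr j => y' j end).
  by move=> [i|i]; rewrite ?El ?Er; [exact: H|exact: H'].
move=> [y H]; split; [exists (y \o inl)|exists (y \o inr)] => i.
  by rewrite -[RHS](H (inl i)) El.
by rewrite -[RHS](H (inr i)) Er.
Qed.

Lemma ppT n : pp (@setT 'rV[M]_n).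
Proof.
suff -> : setT = @pp_sys n void void (fun _ _ => 0) (fun _ _ => 0) (fun=> 0).
  exact: pp_sysP.
by apply/seteqP; split=> // x _; exists (fun=> 0) => -[].
Qed.

Lemma pp_sub m n (s : 'I_m -> 'I_n) (A : set 'rV[M]_m) :
  pp A -> pp [set x : 'rV[M]_n | A (\row_i x 0 (s i))].
Proof.
move=> /pp_sysE[I [J [r [s1 [c ->]]]]].
have := @pp_sysP n I J (fun i j => \sum_(k | s k == j) r i k) s1 c.
congr pp; apply/funext => x; congr (exists y, _); apply/funext => y.
apply: eq_forall => i; congr (_ + _ + _ = 0).
under eq_bigr do rewrite rscale_sum.
rewrite [RHS](partition_big s xpredT) //=; apply: eq_bigr => j _.
by apply: eq_bigr => k /eqP <-; rewrite mxE.
Qed.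

Lemma pp_diag n (i j : 'I_n) : pp [set x : 'rV[M]_n | x 0 i = x 0 j].
Proof.
have := @pp_sysP n unit void (fun _ k => (i == k)%:R - (j == k)%:R)
  (fun _ _ => 0) (fun=> 0).
congr pp; apply/seteqP.
have E (x : 'rV[M]_n) :
    \sum_k rscale (x 0 k) ((i == k)%:R - (j == k)%:R) = x 0 i - x 0 j.
  under eq_bigr do rewrite rscaleB.
  by rewrite sumrB !sum_rscale_delta.
split=> x; last first.
  by move=> xij; exists (fun=> 0) => -[]; rewrite E xij subrr sum_void !addr0.
by move=> [y /(_ tt)]; rewrite E sum_void !addr0 => /subr0_eq.
Qed.

Lemma pp_ex m n (A : set 'rV[M]_(m + n)) :
  pp A -> pp [set x | exists y, A (row_mx x y)].
Proof.
move=> /pp_sysE[I [J [r [s [c ->]]]]].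
have := @pp_sysP m I ('I_n + J)%type (fun i j => r i (lshift n j))
  (fun i j => match j with inl j => r i (rshift m j) | inr k => s i k end) c.
have E (x : 'rV[M]_m) (y : 'rV[M]_n) i :
   \sum_j rscale (row_mx x y 0 j) (r i j) =
   \sum_j rscale (x 0 j) (r i (lshift n j)) + \sum_j rscale (y 0 j) (r i (rshift m j)).
  rewrite big_split_ord /=.
  by congr (_ + _); apply: eq_bigr => j _; rewrite ?row_mxEl ?row_mxEr.
congr pp; apply/seteqP; split=> x.
  move=> [y H]; exists (\row_j y (inl j)), (y \o inr) => i.
  rewrite -[RHS](H i) E big_sumType /= addrA; congr (_ + _ + _ + _).
  by apply: eq_bigr => j _; rewrite mxE.
move=> [y [z H]]; exists (fun k => match k with inl j => y 0 j | inr k => z k end).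
by move=> i; rewrite -[RHS](H i) E big_sumType /= addrA.
Qed.

Lemma pp1 n (p : 'rV[M]_n) : pp [set p].
Proof.
have := @pp_sysP n 'I_n void (fun i j => (i == j)%:R) (fun _ _ => 0)
  (fun i => - p 0 i).
congr pp; apply/seteqP; split=> x /=.
  move=> [y H]; apply/rowP => i; have := H i.
  by rewrite sum_rscale_delta sum_void addr0 => /subr0_eq.
move=> ->; exists (fun=> 0) => i.
by rewrite sum_rscale_delta sum_void addr0 subrr.
Qed.

End PP.

Section DefinableClasses.
Variables (R : pzRingType) (M : lmodType R^c).

Record defset := DefSet {
  def_dim : nat;
  def_dim_gt0 : (0 < def_dim)%N;
  def_car :> set 'rV[M]_def_dim;
  def_carP : definable def_car }.

HB.instance Definition _ := gen_eqMixin defset.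
HB.instance Definition _ := gen_choiceMixin defset.

Definition def_iso m n (A : set 'rV[M]_m) (B : set 'rV[M]_n) : Prop :=
  iso_via (@definable R M) A B.

Definition def_isob (A B : defset) : bool := `[< def_iso A B >].

Lemma def_isob_equiv : equiv_class_of def_isob.
Proof.
split=> [A|A B|B A D].
- by apply/asboolP/iso_refl; [exact: definableI|exact: definableT|
    exact: definable_sub|exact: definable_diag|exact: def_carP].
- by apply/asboolP/asboolP; apply: iso_sym; exact: definable_sub.
- move=> /asboolP AB /asboolP BD; apply/asboolP; move: AB BD.
  by apply: iso_trans; [exact: definableI|exact: definable_sub|exact: definable_ex].
Qed.

Canonical def_isob_equivrel := EquivRelPack def_isob_equiv.
Canonical def_isob_encModRel := defaultEncModRel def_isob.

Definition defclass : Type := {eq_quot def_isob}.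
HB.instance Definition _ := Choice.on defclass.

Definition dclass_of (A : defset) : defclass := \pi A.

Definition dclass n (n_gt0 : (0 < n)%N) (A : set 'rV[M]_n) (dA : definable A)
  : defclass := dclass_of (DefSet n_gt0 dA).

Lemma dclass_ofP (A B : defset) : dclass_of A = dclass_of B <-> def_iso A B.
Proof.
rewrite /dclass_of; split=> [/eqP|H]; last apply/eqP; rewrite piE.
  by move=> /asboolP.
exact/asboolP.
Qed.

Lemma dclass_surj (a : defclass) : exists A : defset, dclass_of A = a.
Proof. by exists (repr a); exact: reprK. Qed.

Lemma definable_prod m n (A : set 'rV[M]_m) (B : set 'rV[M]_n) :
  definable A -> definable B -> definable (prod_set A B).
Proof. by apply: prod_via; [exact: definableI|exact: definable_sub]. Qed.

Definition def_prod (A B : defset) : defset :=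
  DefSet (ltn_addr _ (def_dim_gt0 A))
    (definable_prod (def_carP A) (def_carP B)).

Definition dmul (a b : defclass) : defclass := dclass_of (def_prod (repr a) (repr b)).
Definition done : defclass := dclass (ltn0Sn 0) (definable1 (0 : 'rV[M]_1)).
Definition dzero : defclass := dclass (ltn0Sn 0) (@definable0 R M 1).

Lemma dmulE A B : dmul (dclass_of A) (dclass_of B) = dclass_of (def_prod A B).
Proof.
apply/dclass_ofP; apply: iso_prod;
  [exact: definableI|exact: definable_sub| |]; apply/dclass_ofP; exact: reprK.
Qed.

Lemma dclass_ext n (n0 n0' : (0 < n)%N) (A : set 'rV[M]_n) (dA dA' : definable A) :
  dclass n0 dA = dclass n0' dA'.
Proof. by rewrite (bool_irrelevance n0 n0') (Prop_irrelevance dA dA'). Qed.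

Lemma dmul_dclass m n (m0 : (0 < m)%N) (n0 : (0 < n)%N)
    (A : set 'rV[M]_m) (B : set 'rV[M]_n) (dA : definable A) (dB : definable B) :
  dmul (dclass m0 dA) (dclass n0 dB)
  = dclass (ltn_addr n m0) (definable_prod dA dB).
Proof. exact: dmulE. Qed.

Lemma dmulA : associative dmul.
Proof.
move=> a b c.
have [[A <-] [[B <-] [D <-]]] := (dclass_surj a, (dclass_surj b, dclass_surj c)).
rewrite !dmulE; apply/dclass_ofP; apply: iso_prodA; try exact: def_carP;
  [exact: definableI|exact: definableT|exact: definable_sub|exact: definable_diag].
Qed.

Lemma dmulC : commutative dmul.
Proof.
move=> a b; have [[A <-] [B <-]] := (dclass_surj a, dclass_surj b).
rewrite !dmulE; apply/dclass_ofP; apply: iso_prodC; try exact: def_carP;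
  [exact: definableI|exact: definableT|exact: definable_sub|exact: definable_diag].
Qed.

Lemma dmul1 : left_id done dmul.
Proof.
move=> a; have [A <-] := dclass_surj a.
rewrite dmulE; apply/dclass_ofP; apply: iso_prod1; try exact: def_carP;
  [exact: definableI|exact: definableT|exact: definable_sub|exact: definable_diag
  |exact: definable1].
Qed.

Lemma dmul1r : right_id done dmul.
Proof. by move=> a; rewrite dmulC dmul1. Qed.

(* Required by the library's monoid algebras {malg int[_]}, as is cmul_eq1. *)
Lemma dmul_eq1 a b : dmul a b = done -> a = done /\ b = done.
Proof.
have [[A <-] [B <-]] := (dclass_surj a, dclass_surj b).
rewrite dmulE => /dclass_ofP /iso_point_prod[p [q [Ap Bq]]].
by split; apply/dclass_ofP; rewrite /def_iso ?Ap ?Bq; apply: iso_point;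
  exact: definable1.
Qed.

HB.instance Definition _ :=
  Choice_isMonomialDef.Build defclass dmulA dmul1 dmul1r dmul_eq1.
HB.instance Definition _ := MonomialDef_isConomialDef.Build defclass dmulC.

(* [dsum a b c] : c = [A' |_| B'] for some disjoint A' in a and B' in b.  This
   is the graph of the addition of classes: it is always functional (dsum_fun),
   and total as soon as M has two elements (dsum_total).  For M = 0 disjoint
   representatives of two nonempty classes do not exist, whence a relation. *)
Definition dsum (a b c : defclass) : Prop :=
  exists n (n_gt0 : (0 < n)%N) (A B : set 'rV[M]_n)
         (dA : definable A) (dB : definable B),
    [/\ A `&` B = set0, a = dclass n_gt0 dA, b = dclass n_gt0 dB
      & c = dclass n_gt0 (definableU dA dB)].

Lemma dsum_fun a b c c' : dsum a b c -> dsum a b c' -> c = c'.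
Proof.
move=> [n [n0 [A [B [dA [dB [AB0 -> -> ->]]]]]]].
move=> [n' [n0' [A' [B' [dA' [dB' [AB0' AA' BB' ->]]]]]]].
move/dclass_ofP/iso_relP: AA' => /= [F [CF [dF totF surF funF injF]]].
move/dclass_ofP/iso_relP: BB' => /= [G [CG [dG totG surG funG injG]]].
have FG x x' y y' : F (row_mx x y) -> G (row_mx x' y') -> x <> x' /\ y <> y'.
  move=> /dF[Ax Ay] /dG[Bx By]; split=> e; subst.
    by have : (A `&` B) x' by []; rewrite AB0.
  by have : (A' `&` B') y' by []; rewrite AB0'.
apply/dclass_ofP/iso_relP; exists (F `|` G); split; first exact: definableU.
split=> /=.
- by move=> x y [/dF|/dG] [? ?]; split; (by left) || by right.
- by move=> x [/totF|/totG] [y ?]; exists y; (by left) || by right.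
- by move=> x [/surF|/surG] [y ?]; exists y; (by left) || by right.
- move=> x y y' [H|H] [H'|H']; [exact: funF H H'| | |exact: funG H H'].
    by have [] := FG _ _ _ _ H H'.
  by have [] := FG _ _ _ _ H' H.
- move=> x y y' [H|H] [H'|H']; [exact: injF H H'| | |exact: injG H H'].
    by have [] := FG _ _ _ _ H H'.
  by have [] := FG _ _ _ _ H' H.
Qed.

Lemma dsum_total : (exists x : M, x != 0) -> forall a b, exists c, dsum a b c.
Proof.
move=> [x0 x0N] a b; have [[A <-] [B <-]] := (dclass_surj a, dclass_surj b).
case: A B => m m0 A dA [n n0 B dB].
pose p (x : M) : 'rV[M]_1 := const_mx x.
pose A' := prod_set (prod_set A [set 0 : 'rV[M]_n]) [set p 0].
pose B' := prod_set (prod_set [set 0 : 'rV[M]_m] B) [set p x0].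
have dA' : definable A' by do 2 (apply: definable_prod; last exact: definable1).
have dB' : definable B'.
  apply: definable_prod; last exact: definable1.
  by apply: definable_prod; [exact: definable1|].
have mn0 : (0 < m + n + 1)%N by rewrite addn1.
exists (dclass mn0 (definableU dA' dB')).
exists (m + n + 1)%N, mn0, A', B', dA', dB'; split=> //.
- apply/seteqP; split=> // z [[_ /= e] [_ /= e']]; move: x0N.
  by rewrite e in e'; have /rowP/(_ 0) := e'; rewrite !mxE => ->; rewrite eqxx.
- transitivity (dmul (dmul (dclass m0 dA) (dclass n0 (definable1 (0 : 'rV[M]_n))))
                  (dclass (ltn0Sn 0) (definable1 (p 0)))).
    suff -> : dclass n0 (definable1 (0 : 'rV[M]_n)) = done.
      suff -> : dclass (ltn0Sn 0) (definable1 (p 0)) = done by rewrite !dmul1r.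
      by apply/dclass_ofP/iso_point/definable1.
    by apply/dclass_ofP/iso_point/definable1.
  by rewrite !dmul_dclass; exact: dclass_ext.
transitivity (dmul (dmul (dclass m0 (definable1 (0 : 'rV[M]_m))) (dclass n0 dB))
                  (dclass (ltn0Sn 0) (definable1 (p x0)))).
  suff -> : dclass m0 (definable1 (0 : 'rV[M]_m)) = done.
    suff -> : dclass (ltn0Sn 0) (definable1 (p x0)) = done by rewrite dmul1r dmul1.
    by apply/dclass_ofP/iso_point/definable1.
  by apply/dclass_ofP/iso_point/definable1.
by rewrite !dmul_dclass; exact: dclass_ext.
Qed.

Definition def_semiring_morphism (S : comPzRingType) (f : defclass -> S) : Prop :=
  [/\ f dzero = 0, f done = 1,
      forall a b c, dsum a b c -> f c = f a + f b
    & forall a b, f (dmul a b) = f a * f b].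

Definition K0_rel : set {malg int[defclass]} :=
  [set z | z = << dzero >> \/
     exists a b c, dsum a b c /\ z = << c >> - (<< a >> + << b >>)].

(* The monoid ring of (classes, dmul, done) modulo the additive relations: by
   K0_class_morphism and K0_universal this is the commutative ring with the
   universal semiring morphism from the classes. *)
Definition K0 : comPzRingType := quot_span K0_rel.

Definition K0_class (a : defclass) : K0 := quot_pi K0_rel << a >>.

Lemma K0_class_morphism : def_semiring_morphism K0_class.
Proof.
split=> [||a b c abc|a b].
- by rewrite /K0_class -(raddf0 (quot_pi K0_rel)); apply/quot_piP/mem_ideal_span; left; rewrite subr0.
- by [].
- rewrite /K0_class -raddfD; apply/quot_piP/mem_ideal_span; right.
  by exists a, b, c.
- by rewrite /K0_class -rmorphM malgM_def fgmulUU mulr1.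
Qed.

Lemma K0_universal (S : comPzRingType) (f : defclass -> S) :
  def_semiring_morphism f ->
  exists h : {rmorphism K0 -> S},
    (forall a, h (K0_class a) = f a) /\
    forall h' : {rmorphism K0 -> S}, (forall a, h' (K0_class a) = f a) -> h' =1 h.
Proof.
move=> [f0 f1 fD fM].
pose g (z : {malg int[defclass]}) : S := \sum_(k <- msupp z) f k *~ z@_k.
have gE (d : {fset defclass}) z : (msupp z `<=` d)%fset ->
    g z = \sum_(k <- d) f k *~ z@_k.
  move=> zd; rewrite /g (big_fset_incl _ zd) // => k _ kz.
  by rewrite mcoeff_outdom // mulr0z.
have gU k : g << k >> = f k.
  by rewrite /g msuppU oner_eq0 big_seq_fset1 mcoeffUU.
have gB : zmod_morphism g.
  move=> x y; pose d := (msupp x `|` msupp y)%fset.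
  have xd : (msupp x `<=` d)%fset by exact: fsubsetUl.
  have yd : (msupp y `<=` d)%fset by exact: fsubsetUr.
  rewrite (gE _ _ xd) (gE _ _ yd) (gE d); last exact: fsubset_trans (msuppB_le _ _) _.
  by rewrite -sumrB; apply: eq_bigr => k _; rewrite mcoeffB mulrzBr.
pose gA := GRing.isZmodMorphism.Build _ _ g gB.
pose g' : {additive {malg int[defclass]} -> S} := HB.pack g gA.
have gZ k c : g << c *g k >> = f k *~ c.
  rewrite (gE [fset k]%fset) ?msuppU_le // big_seq_fset1.
  by rewrite mcoeffUU.
have gM : monoid_morphism g.
  split=> [|x y]; first by rewrite -[RHS]f1 -gU.
  rewrite (monalgE x) (monalgE y) mulr_suml -[g]/(g' : _ -> _) !raddf_sum mulr_suml.
  apply: eq_bigr => k _; rewrite mulr_sumr raddf_sum mulr_sumr.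
  apply: eq_bigr => l _; rewrite malgM_def fgmulUU [LHS]gZ.
  by rewrite [g' << _ *g k >>]gZ [g' << _ *g l >>]gZ fM mulrzAl mulrzAr -mulrzA (mulrC (y@__)).
pose gR := GRing.isMonoidMorphism.Build _ _ g gM.
pose h0 : {rmorphism {malg int[defclass]} -> S} := HB.pack g gA gR.
have hK z : ideal_span K0_rel z -> g z = 0.
  move=> [s [sK ->]]; rewrite -[g]/(h0 : _ -> _) rmorph_sum big1_seq //.
  move=> p /andP[_ /sK Kp]; rewrite rmorphM.
  suff -> : h0 p.2 = 0 by rewrite mulr0.
  case: Kp => [->|[a [b [c [abc ->]]]]]; first by rewrite [LHS]gU.
  rewrite rmorphB rmorphD; apply/eqP; rewrite subr_eq0; apply/eqP.
  by rewrite ![h0 _]gU; apply: fD.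
have hP z : exists y : S, forall a, quot_pi K0_rel a = z -> g a = y.
  have [a <-] := quot_pi_surj z; exists (g a) => b /quot_piP /hK.
  by rewrite gB => /subr0_eq.
have [h hE] := choice hP.
have hg a : h (quot_pi K0_rel a) = g a by apply/esym/hE.
have hB : zmod_morphism (h : K0 -> S).
  move=> x y; have [[a <-] [b <-]] := (quot_pi_surj x, quot_pi_surj y).
  by rewrite -raddfB !hg gB.
have hM : monoid_morphism (h : K0 -> S).
  split=> [|x y]; first by rewrite -(gM.1) -hg rmorph1.
  have [[a <-] [b <-]] := (quot_pi_surj x, quot_pi_surj y).
  by rewrite -rmorphM !hg gM.2.
pose hA := GRing.isZmodMorphism.Build K0 S h hB.
pose hR := GRing.isMonoidMorphism.Build K0 S h hM.
exists (HB.pack h hA hR : {rmorphism K0 -> S}); split=> [a|h' h'E x] /=.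
  by rewrite hg gU.
have [a <-] := quot_pi_surj x; rewrite hg.
rewrite (monalgE a) -[g]/(g' : _ -> _) !raddf_sum; apply: eq_bigr => k _.
rewrite [RHS]gZ -(h'E k) /K0_class -!raddfMz; congr (h' (quot_pi _ _)).
by rewrite intz.
Qed.

End DefinableClasses.

Section Colours.
Variables (R : pzRingType) (M : lmodType R^c).

Record ppset := PPSet {
  pp_dim : nat;
  pp_dim_gt0 : (0 < pp_dim)%N;
  pp_car :> set 'rV[M]_pp_dim;
  pp_carP : pp pp_car;
  pp_neq0 : pp_car !=set0 }.

HB.instance Definition _ := gen_eqMixin ppset.
HB.instance Definition _ := gen_choiceMixin ppset.

Definition pp_iso m n (A : set 'rV[M]_m) (B : set 'rV[M]_n) : Prop :=
  iso_via (@pp R M) A B.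

Definition pp_isob (A B : ppset) : bool := `[< pp_iso A B >].

Lemma pp_isob_equiv : equiv_class_of pp_isob.
Proof.
split=> [A|A B|B A D].
- by apply/asboolP/iso_refl; [exact: ppI|exact: ppT|exact: pp_sub|
    exact: pp_diag|exact: pp_carP].
- by apply/asboolP/asboolP; apply: iso_sym; exact: pp_sub.
- move=> /asboolP AB /asboolP BD; apply/asboolP; move: AB BD.
  by apply: iso_trans; [exact: ppI|exact: pp_sub|exact: pp_ex].
Qed.

Canonical pp_isob_equivrel := EquivRelPack pp_isob_equiv.
Canonical pp_isob_encModRel := defaultEncModRel pp_isob.

Definition colour : Type := {eq_quot pp_isob}.
HB.instance Definition _ := Choice.on colour.

Definition colour_of (P : ppset) : colour := \pi P.

Lemma colour_ofP (P Q : ppset) : colour_of P = colour_of Q <-> pp_iso P Q.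
Proof.
rewrite /colour_of; split=> [/eqP|H]; last apply/eqP; rewrite piE.
  by move=> /asboolP.
exact/asboolP.
Qed.

Lemma colour_surj (a : colour) : exists P : ppset, colour_of P = a.
Proof. by exists (repr a); exact: reprK. Qed.

Lemma pp_prod m n (A : set 'rV[M]_m) (B : set 'rV[M]_n) :
  pp A -> pp B -> pp (prod_set A B).
Proof. by apply: prod_via; [exact: ppI|exact: pp_sub]. Qed.

Lemma prod_set_neq0 m n (A : set 'rV[M]_m) (B : set 'rV[M]_n) :
  A !=set0 -> B !=set0 -> prod_set A B !=set0.
Proof.
by move=> [x Ax] [y By]; exists (row_mx x y); split; rewrite ?row_mxKl ?row_mxKr.
Qed.

Lemma set1_neq0 n (p : 'rV[M]_n) : [set p] !=set0.
Proof. by exists p. Qed.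

Definition ppset_prod (P Q : ppset) : ppset :=
  PPSet (ltn_addr _ (pp_dim_gt0 P)) (pp_prod (pp_carP P) (pp_carP Q))
    (prod_set_neq0 (pp_neq0 P) (pp_neq0 Q)).

Definition cmul (a b : colour) : colour :=
  colour_of (ppset_prod (repr a) (repr b)).

Definition cone : colour :=
  colour_of (PPSet (ltn0Sn 0) (pp1 (0 : 'rV[M]_1)) (set1_neq0 0)).

Lemma cmulE P Q : cmul (colour_of P) (colour_of Q) = colour_of (ppset_prod P Q).
Proof.
apply/colour_ofP; apply: iso_prod;
  [exact: ppI|exact: pp_sub| |]; apply/colour_ofP; exact: reprK.
Qed.

Lemma cmulA : associative cmul.
Proof.
move=> a b c.
have [[A <-] [[B <-] [D <-]]] := (colour_surj a, (colour_surj b, colour_surj c)).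
rewrite !cmulE; apply/colour_ofP; apply: iso_prodA; try exact: pp_carP;
  [exact: ppI|exact: ppT|exact: pp_sub|exact: pp_diag].
Qed.

Lemma cmulC : commutative cmul.
Proof.
move=> a b; have [[A <-] [B <-]] := (colour_surj a, colour_surj b).
rewrite !cmulE; apply/colour_ofP; apply: iso_prodC; try exact: pp_carP;
  [exact: ppI|exact: ppT|exact: pp_sub|exact: pp_diag].
Qed.

Lemma cmul1 : left_id cone cmul.
Proof.
move=> a; have [A <-] := colour_surj a.
rewrite cmulE; apply/colour_ofP; apply: iso_prod1; try exact: pp_carP;
  [exact: ppI|exact: ppT|exact: pp_sub|exact: pp_diag|exact: pp1].
Qed.

Lemma cmul1r : right_id cone cmul.
Proof. by move=> a; rewrite cmulC cmul1. Qed.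

Lemma cmul_eq1 a b : cmul a b = cone -> a = cone /\ b = cone.
Proof.
have [[A <-] [B <-]] := (colour_surj a, colour_surj b).
rewrite cmulE => /colour_ofP /iso_point_prod[p [q [Ap Bq]]].
by split; apply/colour_ofP; rewrite /pp_iso ?Ap ?Bq; apply: iso_point;
  exact: pp1.
Qed.

HB.instance Definition _ :=
  Choice_isMonomialDef.Build colour cmulA cmul1 cmul1r cmul_eq1.
HB.instance Definition _ := MonomialDef_isConomialDef.Build colour cmulC.

(* P - p for a point p of P; for a nonempty pp-set, i.e. a coset, the result
   does not depend on p. *)
Definition direction n (P : set 'rV[M]_n) : set 'rV[M]_n :=
  [set x - xget 0 P | x in P].

Definition cosets n (G H : set 'rV[M]_n) : set (set 'rV[M]_n) :=
  [set [set g + h | h in H] | g in G].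

(* [pp_index P Q k] : the index [P : Q] is finite and equal to k. *)
Definition pp_index n (P Q : set 'rV[M]_n) (k : nat) : Prop :=
  (cosets (direction P) (direction P `&` direction Q) #= `I_k)%card.

Definition invariants_rel : set {malg int[colour]} :=
  [set z | exists n (n_gt0 : (0 < n)%N) (P Q : set 'rV[M]_n)
     (ppP : pp P) (ppQ : pp Q) (P0 : P !=set0) (Q0 : Q !=set0) (k : nat),
     [/\ Q `<=` P, pp_index P Q k
       & z = << colour_of (PPSet n_gt0 ppP P0) >>
             - << colour_of (PPSet n_gt0 ppQ Q0) >> *+ k]].

(* Z[colours] / J, where J is the ideal generated by invariants_rel. *)
Definition colour_ring_mod_invariants : comPzRingType :=
  quot_span invariants_rel.

End Colours.

Arguments K0 {R} M.
Arguments colour {R} M.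
Arguments invariants_rel {R} M.
Arguments colour_ring_mod_invariants {R} M.

(* Main.v *)
From HB Require Import structures.
Require Import Defs.
From mathcomp Require Import all_boot all_order all_algebra.
From mathcomp Require Import boolp classical_sets functions cardinality.
From mathcomp Require Import finmap monalg.

(* A pp-set is empty or a coset.  By Neumann's lemma a coset of a group N is not
   a finite union of cosets of subgroups of infinite index in N, and this is the
   only input about subgroups.  It gives
   - quantifier elimination: the indicator of a definable set is an integral
     combination of indicators of pp-sets;
   - that a relation sum_i c_i 1_{P_i} = 0 between indicators of pp-sets implies
     sum_i c_i [[P_i]] = 0 modulo the invariants ideal: in a maximal
     commensurability class of directions the coefficients on the cosets of a
     common subgroup of finite index must all vanish.
   Hence euler A := sum_i c_i [[P_i]] for 1_A = sum_i c_i 1_{P_i} is well defined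
   on definable sets, additive and multiplicative.  It is invariant under
   definable bijections because the graph of such a bijection is covered by
   finitely many pp-sets on which both projections are injective.  The inverse
   of the induced morphism sends the colour of P to the class of P. *)

Set Implicit Arguments.
Unset Strict Implicit.
Unset Printing Implicit Defensive.
Import Order.TTheory GRing.Theory Num.Theory.
Local Open Scope classical_set_scope.
Local Open Scope ring_scope.

(** * Finite index and Neumann's lemma *)

(** An asymmetry between the two rings shapes the proof. In [K0 M] every definable piece has a
    class, so a linear relation between indicators passes to classes by cutting sets up. In the
    colour ring only pp-sets have classes, and a difference of two pp-sets has none; a relation must
    there be traced back to index relations. Neumann's lemma does this, each time in the same form:
    if a coset z + N lies in a finite union of pp-sets, one of them has a direction of finite index
    in N. So sets of infinite index never hide a whole coset of N; once they are discarded, only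
    finitely many cosets of N have to be counted. Such counts are linear in indicators, whereas
    existence of a point is not, which is why simple functions are shown to be closed under
    arbitrary maps of their values. Directions are compared through the index of their intersection,
    since one subgroup can be contained in another up to finite index without being contained in it.
    A definable bijection is replaced by its graph: domain and image are both coordinate projections
    of it, so invariance only concerns coordinate maps that are injective on a definable set. *)

Section AbelianGroupReflection.
Variable V : zmodType.

(** Additive identities are settled by reflection: both sides become integer combinations of the
    same atoms, and only coefficients are compared. *)
Inductive zexpr :=
  ZVar of nat | ZZero | ZOpp of zexpr | ZAdd of zexpr & zexpr.

Fixpoint zeval (e : seq V) t : V :=
  match t with
  | ZVar i => e`_i
  | ZZero => 0
  | ZOpp t => - zeval e t
  | ZAdd t u => zeval e t + zeval e u
  end.

Fixpoint zcoef t (i : nat) : int :=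
  match t with
  | ZVar j => (j == i)%:Z
  | ZZero => 0
  | ZOpp t => - zcoef t i
  | ZAdd t u => zcoef t i + zcoef u i
  end.

Lemma zevalE e t : zeval e t = \sum_(i < size e) e`_i *~ zcoef t i.
Proof.
elim: t => [j||t IH|t IHt u IHu] /=; last first.
- by rewrite IHt IHu -big_split; apply: eq_bigr => i _; rewrite mulrzDr.
- by rewrite IH -sumrN; apply: eq_bigr => i _; rewrite mulrNz.
- by rewrite big1.
have [je|ej] := ltnP j (size e).
  rewrite (bigD1 (Ordinal je)) //= eqxx big1 ?addr0 // => i.
  by rewrite -val_eqE eq_sym /= => /negbTE->.
rewrite nth_default // big1 // => i _.
by rewrite gtn_eqF // (leq_trans (ltn_ord i) ej).
Qed.

Lemma zeval_eq e t u :
  all (fun i => zcoef t i == zcoef u i) (iota 0 (size e)) ->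
  zeval e t = zeval e u.
Proof.
move=> /allP tu; rewrite !zevalE; apply: eq_bigr => i _.
by rewrite (eqP (tu i _)) // mem_iota ltn_ord.
Qed.

End AbelianGroupReflection.

(* Atoms are compared up to conversion, as the inferred structures may differ. *)
Ltac zvar_index x e :=
  match e with
  | ?y :: _ => let _ := match constr:(tt) with _ => unify x y end in constr:(O)
  | _ :: ?e' => let n := zvar_index x e' in constr:(S n)
  end.

Ltac zvars e t :=
  match t with
  | 0%R => e
  | (- ?x)%R => zvars e x
  | (?x + ?y)%R => let e' := zvars e x in zvars e' y
  | _ => match e with
         | _ => let n := zvar_index t e in e
         | _ => constr:(t :: e)
         end
  end.

Ltac zquote e t :=
  match t with
  | 0%R => constr:(ZZero)
  | (- ?x)%R => let u := zquote e x in constr:(ZOpp u)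
  | (?x + ?y)%R => let u := zquote e x in let v := zquote e y in constr:(ZAdd u v)
  | _ => let n := zvar_index t e in constr:(ZVar n)
  end.

Ltac zmod :=
  match goal with
  | |- @eq ?T ?x ?y =>
    let e0 := zvars (@nil T) x in let e := zvars e0 y in
    let t := zquote e x in let u := zquote e y in
    exact: (@zeval_eq _ e t u isT)
  end.

Section Index.
Variable V : zmodType.
Implicit Types (G H K N A : set V) (x y z a b : V) (l : seq V).

Definition subgrp H := H 0 /\ forall x y, H x -> H y -> H (x - y).

(** These are the empty set and the cosets of subgroups, described without a base point. *)
Definition affine A := forall x y z, A x -> A y -> A z -> A (x - y + z).

(* For subgroups: [G : G `&` H] is finite; the representatives need not lie in G. *)
Definition fin_index G H :=
  exists l, forall x, G x -> exists2 a, a \in l & H (x - a).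

(** [G] may be any set, since the notion is applied to cosets and to finite unions of cosets as well
    as to groups. *)
Definition transversal G N l :=
  [/\ uniq l, forall a, a \in l -> G a,
      forall x, G x -> exists2 a, a \in l & N (x - a) &
      forall a b, a \in l -> b \in l -> N (a - b) -> a = b].

Lemma subgrpN H x : subgrp H -> H x -> H (- x).
Proof. by move=> [H0 HB] Hx; rewrite -sub0r; apply: HB. Qed.

Lemma subgrpD H x y : subgrp H -> H x -> H y -> H (x + y).
Proof. by move=> sH Hx Hy; rewrite -[y]opprK; apply: sH.2 => //; apply: subgrpN. Qed.

Lemma subgrp_subC H x y : subgrp H -> H (x - y) -> H (y - x).
Proof. by move=> sH Hx; rewrite -opprB; apply: subgrpN. Qed.

Lemma subgrp_trans H y x z : subgrp H -> H (x - y) -> H (y - z) -> H (x - z).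
Proof. by move=> sH xy yz; rewrite -(subrKA y); apply: subgrpD. Qed.

Lemma subgrpT : subgrp setT. Proof. by []. Qed.

Lemma subgrpI H K : subgrp H -> subgrp K -> subgrp (H `&` K).
Proof.
move=> [H0 HB] [K0 KB]; split=> // x y [Hx Kx] [Hy Ky].
by split; [apply: HB|apply: KB].
Qed.

Lemma fin_index_subr G H H' : H `<=` H' -> fin_index G H -> fin_index G H'.
Proof. by move=> sH [l lP]; exists l => x /lP[a al /sH]; exists a. Qed.

Lemma fin_index_refl G : fin_index G G.
Proof. by exists [:: 0] => x Gx; exists 0; rewrite ?mem_head // subr0. Qed.

Lemma fin_index_trans H G K : fin_index G H -> fin_index H K -> fin_index G K.
Proof.
move=> [l lP] [k kP]; exists [seq a + b | a <- l, b <- k] => x /lP[a al].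
move=> /kP[b bk Kb]; exists (a + b); first by apply/allpairsP; exists (a, b).
by rewrite opprD addrA.
Qed.

Lemma fin_indexI G H K : subgrp H -> subgrp K ->
  fin_index G H -> fin_index G K -> fin_index G (H `&` K).
Proof.
move=> sH sK [l lP] [k kP].
(* A common point of a + H and b + K; the default 0 only arises for pairs of cosets that do not
   meet, and no [x] selects these. *)
pose c a b := xget 0 [set y | H (y - a) /\ K (y - b)].
exists [seq c a b | a <- l, b <- k] => x Gx.
have [[a al Ha] [b bk Kb]] := (lP x Gx, kP x Gx).
exists (c a b); first by apply/allpairsP; exists (a, b).
have [Hc Kc] : H (c a b - a) /\ K (c a b - b).
  by rewrite /c; case: xgetP => [y _ //|/(_ x)[]].
by split; [apply: (subgrp_trans sH Ha)|apply: (subgrp_trans sK Kb)];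
  apply: subgrp_subC.
Qed.

(* B. H. Neumann: if some coset g + H of one of the subgroups is not used, it is
   covered by the cosets of the other subgroups, hence so is every coset of H,
   and H can be dropped from the list. *)
Lemma neumann G (c : seq (seq V * set V)) : subgrp G ->
  (forall p, p \in c -> subgrp p.2) ->
  (forall x, G x -> exists2 p, p \in c & exists2 a, a \in p.1 & p.2 (x - a)) ->
  exists2 p, p \in c & fin_index G p.2.
Proof.
move=> sG; move: {2}(size c) (erefl (size c)) => m.
elim: m c => [|m IH] [|[l H] c] //= => [_|[szc]] sc cov.
  by have [] := cov 0 sG.1.
have [GH|] := pselect (forall x, G x -> exists2 a, a \in l & H (x - a)).
  by exists (l, H); rewrite ?mem_head //; exists l.
move=> /existsNP[g /not_implyP[Gg gN]].
have sH : subgrp H by apply: (sc (l, H)); rewrite mem_head.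
(* The listed representatives may lie outside [G]; [rep a] moves them into it whenever a + H meets
   [G]. *)
pose rep a := xget 0 [set y | G y /\ H (y - a)].
(* A point of a + H in [G] is rep a + h with h in [G] and [H]; translating it by g - rep a gives g +
   h, which the other subgroups cover. Undoing the translation gives the new representatives, and
   the old ones stay for the points not covered through [H]. *)
pose sh (p : seq V * set V) :=
  ([seq b + (rep a - g) | b <- p.1, a <- l] ++ p.1, p.2).
suff [_ /mapP[p pc ->] fp] : exists2 p, p \in map sh c & fin_index G p.2.
  by exists p; [rewrite in_cons pc orbT|exact: fp].
have covg h : G h -> H h -> exists2 p, p \in c &
    exists2 a, a \in p.1 & p.2 (g + h - a).
  move=> Gh Hh; have [p] := cov (g + h) (subgrpD sG Gg Gh).
  rewrite inE => /orP[/eqP-> [a al /= Ha]|pc]; last by exists p.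
  case: gN; exists a => //; rewrite -(addrK h g) addrAC.
  by apply: sH.2.
apply: IH => [|_ /mapP[p pc ->]|x Gx]; first by rewrite size_map.
  by apply: (sc p); rewrite in_cons pc orbT.
have [p] := cov x Gx; rewrite in_cons => /orP[/eqP->{p} [a al /= Ha]|pc [a ap Ha]].
  have [Gr Hr] : G (rep a) /\ H (rep a - a).
    by rewrite /rep; case: xgetP => [y _ //|/(_ x)[]].
  have [||p pc [b bp Hb]] := covg (x - rep a); first exact: sG.2.
    by apply: (subgrp_trans sH Ha); apply: subgrp_subC.
  exists (sh p); first exact: map_f.
  exists (b + (rep a - g)).
    by rewrite mem_cat; apply/orP; left; apply/allpairsP; exists (b, a).
  by congr (p.2 _): Hb; zmod.
exists (sh p); first exact: map_f.
by exists a; rewrite // mem_cat ap orbT.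
Qed.

(** Because [G] is an arbitrary set, the points of the first coset can be removed from it in the
    induction; that coset receives a representative only if it meets [G]. *)
Lemma transversal_exists G N : subgrp N -> fin_index G N ->
  exists l, transversal G N l.
Proof.
move=> sN [l]; elim: l G => [|a l IH] G lP.
  by exists [::]; split=> // x /lP[].
pose G' := [set x | G x /\ ~ N (x - a)].
have [x [Gx Nx]|l' [ul' l'G covl' sepl']] := IH G'.
  have [b] := lP x Gx; rewrite inE => /orP[/eqP-> //|bl Nb]; by exists b.
have [[g [Gg Ng]]|nog] := pselect (exists g, G g /\ N (g - a)); last first.
  exists l'; split=> // [x /l'G[]//|x Gx]; apply: covl'; split=> // Nx.
  by apply: nog; exists x.
have gl' b : b \in l' -> ~ N (g - b).
  move=> /l'G[_ Nb] /(subgrp_subC sN) gb; apply: Nb.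
  exact: (subgrp_trans sN gb).
exists (g :: l'); split=> /=.
- rewrite ul' andbT; apply/negP => /gl'; apply; rewrite subrr; exact: sN.1.
- by move=> b; rewrite inE => /orP[/eqP-> //|/l'G[]].
- move=> x Gx; have [Nx|Nx] := pselect (N (x - a)).
    exists g; rewrite ?mem_head //; apply: (subgrp_trans sN Nx).
    exact: subgrp_subC.
  by have [//|b bl Nb] := covl' x; exists b; rewrite // inE bl orbT.
- move=> b c; rewrite !inE => /orP[/eqP->|bl] /orP[/eqP->|cl] //.
  + by move=> gc; case: (gl' c cl gc).
  + by move=> /(subgrp_subC sN) gb; case: (gl' b bl gb).
  + exact: sepl'.
Qed.

(* Translation by t permutes the cosets of N in G. *)
Lemma count_transversal_shift G N l (A : set V) t : subgrp G -> subgrp N ->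
  transversal G N l -> G t ->
  (forall x y, N (x - y) -> A x -> A y) ->
  count (fun a => `[< A (t + a) >]) l = count (fun a => `[< A a >]) l.
Proof.
move=> sG sN [ul lG lcov lsep] Gt NA.
pose f a := xget 0 [set b | b \in l /\ N (t + a - b)].
have fP a : a \in l -> f a \in l /\ N (t + a - f a).
  move=> al; rewrite /f; case: xgetP => [b _ //|].
  have [b bl Nb] := lcov (t + a) (subgrpD sG Gt (lG _ al)).
  by move=> /(_ b)[].
have finj : {in l &, injective f}.
  move=> a b al bl fab; have [[_ Na] [_ Nb]] := (fP a al, fP b bl).
  apply: lsep => //; have := sN.2 _ _ Na Nb; rewrite fab; congr N; zmod.
have perm_f : perm_eq (map f l) l.
  have umap : uniq (map f l) by rewrite map_inj_in_uniq.
  apply: uniq_perm => //; apply: (uniq_min_size umap _ _).2; last by rewrite size_map.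
  by move=> _ /mapP[a al ->]; have [] := fP a al.
rewrite -[RHS](permP perm_f) count_map; apply: eq_in_count => a al /=.
have [_ Na] := fP a al; apply: asbool_equiv_eq; split=> [Ata|Afa]; first exact: NA Na Ata.
by apply: NA Afa; apply: subgrp_subC.
Qed.
End Index.

(** * Coordinate maps and pp-sets *)

Section CoordinateMaps.
Variables (R : pzRingType) (M : lmodType R^c).

Definition coord k n (s : 'I_k -> 'I_n) (x : 'rV[M]_n) : 'rV[M]_k :=
  \row_i x 0 (s i).

Lemma coordB k n (s : 'I_k -> 'I_n) : {morph coord s : x y / x - y}.
Proof. by move=> x y; apply/rowP => i; rewrite !mxE. Qed.

Lemma coordD k n (s : 'I_k -> 'I_n) : {morph coord s : x y / x + y}.
Proof. by move=> x y; apply/rowP => i; rewrite !mxE. Qed.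

Lemma coord_lshift m n (x : 'rV[M]_(m + n)) : coord (lshift n) x = lsubmx x.
Proof. by apply/rowP => i; rewrite !mxE. Qed.

Lemma coord_rshift m n (x : 'rV[M]_(m + n)) : coord (@rshift m n) x = rsubmx x.
Proof. by apply/rowP => i; rewrite !mxE. Qed.

Variable C : forall n, set 'rV[M]_n -> Prop.
Hypothesis CI : forall n (A B : set 'rV[M]_n), C A -> C B -> C (A `&` B).
Hypothesis CT : forall n, C (@setT 'rV[M]_n).
Hypothesis Csub : forall m n (s : 'I_m -> 'I_n) (A : set 'rV[M]_m),
  C A -> C [set x : 'rV[M]_n | A (\row_i x 0 (s i))].
Hypothesis Cdiag : forall n (i j : 'I_n), C [set x : 'rV[M]_n | x 0 i = x 0 j].
Hypothesis Cex : forall m n (A : set 'rV[M]_(m + n)),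
  C A -> C [set x | exists y, A (row_mx x y)].

Lemma forall_via k n (A : 'I_k -> set 'rV[M]_n) :
  (forall i, C (A i)) -> C [set x | forall i, A i x].
Proof.
move=> CA.
have H (s : seq 'I_k) : C [set x | forall i, i \in s -> A i x].
  elim: s => [|i s IH].
    by have := CT n; congr C; apply/seteqP; split.
  have := CI (CA i) IH; congr C; apply/seteqP; split=> x /=.
    by move=> [Ai As] j; rewrite inE => /orP[/eqP->|/As].
  by move=> As; split=> [|j js]; apply: As; rewrite inE ?eqxx ?js ?orbT.
have := H (enum 'I_k); congr C; apply/seteqP; split=> x /= Ax i; last by [].
by apply: Ax; rewrite mem_enum.
Qed.

Lemma image_coord_via k n (s : 'I_k -> 'I_n) (A : set 'rV[M]_n) :
  C A -> C (coord s @` A).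
Proof.
move=> CA.
have := @Cex k n [set z | A (rsubmx z) /\
  forall i, z 0 (lshift n i) = z 0 (rshift k (s i))].
set B := (X in C X -> _) => H; have : C B.
  apply: CI.
    have := Csub (@rshift k n) CA; congr C; apply/funext => z /=.
    by rewrite -coord_rshift.
  by apply: forall_via => i; apply: Cdiag.
move=> /H; congr C; apply/seteqP; split=> x /=.
  move=> [y []]; rewrite row_mxKr => Ay E; exists y => //.
  by apply/rowP => i; rewrite mxE; have := E i; rewrite row_mxEl row_mxEr.
move=> [y Ay <-]; exists y; rewrite /B /= row_mxKr; split=> // i.
by rewrite row_mxEl row_mxEr mxE.
Qed.

End CoordinateMaps.

Section PPSets.
Variables (R : pzRingType) (M : lmodType R^c).

Lemma rscaleDl (x y : M) (r : R) : rscale (x + y) r = rscale x r + rscale y r.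
Proof. exact: scalerDr. Qed.

Lemma rscaleNl (x : M) (r : R) : rscale (- x) r = - rscale x r.
Proof. exact: scalerN. Qed.

Lemma pp_affine n (A : set 'rV[M]_n) : pp A -> affine A.
Proof.
move=> /pp_sysE[I [J [r [s [c ->]]]]] x y z [x' Hx] [y' Hy] [z' Hz].
exists (fun k => x' k - y' k + z' k) => i.
under [X in X + _ + _]eq_bigr do rewrite !mxE !rscaleDl rscaleNl.
under [X in _ + X + _]eq_bigr do rewrite !rscaleDl rscaleNl.
rewrite !big_split !sumrN /=.
have := Hx i; have := Hy i; have := Hz i.
set x1 := \sum_j rscale (x 0 j) _; set x2 := \sum_j rscale (x' j) _.
set y1 := \sum_j rscale (y 0 j) _; set y2 := \sum_j rscale (y' j) _.
set z1 := \sum_j rscale (z 0 j) _; set z2 := \sum_j rscale (z' j) _.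
move=> Ez Ey Ex.
transitivity ((x1 + x2 + c i) - (y1 + y2 + c i) + (z1 + z2 + c i)); first zmod.
by rewrite Ex Ey Ez subrr addr0.
Qed.

Lemma pp_shift n (A : set 'rV[M]_n) a : pp A -> pp [set x | A (x + a)].
Proof.
move=> /pp_sysE[I [J [r [s [c ->]]]]].
have := pp_sysP r s (fun i => c i + \sum_j rscale (a 0 j) (r i j)).
congr pp; apply/funext => x; congr (exists y, _); apply/funext => y.
apply: eq_forall => i.
under [in RHS]eq_bigr do rewrite mxE rscaleDl.
rewrite big_split /=; congr (_ = 0).
set u := \sum_j _; set v := \sum_j rscale (a 0 j) _; set w := \sum_k _; zmod.
Qed.

Lemma pp_coset n (A : set 'rV[M]_n) a : pp A -> pp [set x | A (x - a)].
Proof. exact: pp_shift. Qed.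

Lemma pp_image_coord k n (s : 'I_k -> 'I_n) (A : set 'rV[M]_n) :
  pp A -> pp (coord s @` A).
Proof.
by apply: image_coord_via; [exact: ppI|exact: ppT|exact: pp_sub|exact: pp_diag|exact: pp_ex].
Qed.

Lemma definable_image_coord k n (s : 'I_k -> 'I_n) (A : set 'rV[M]_n) :
  definable A -> definable (coord s @` A).
Proof.
by apply: image_coord_via; [exact: definableI|exact: definableT|exact: definable_sub|
  exact: definable_diag|exact: definable_ex].
Qed.

Lemma term_sum (V : Type) (I : Type) (r : seq I) (v : I -> V) (a : I -> R) :
  exists t : term M V, forall e,
    eval e t = \sum_(i <- r) rscale (e (v i)) (a i).
Proof.
elim: r => [|i r [t E]]; first by exists (TZero M V) => e; rewrite big_nil.
by exists (TAdd (TMul (TVar M (v i)) (a i)) t) => e /=; rewrite E big_cons.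
Qed.

Lemma pp_definable n (A : set 'rV[M]_n) : pp A -> definable A.
Proof.
move=> [m [t [r [s [c ->]]]]].
have := @definable_ex R M n m [set z | forall i,
  \sum_j rscale (z 0 (lshift m j)) (r i j) +
  \sum_k rscale (z 0 (rshift n k)) (s i k) + c 0 i = 0].
set B := (X in definable X -> _) => H; have : definable B.
  apply: forall_via => [? ? ?|?|i]; [exact: definableI|exact: definableT|].
  have [t1 E1] := term_sum (index_enum 'I_n) (lshift m) (r i).
  have [t2 E2] := term_sum (index_enum 'I_m) (@rshift n m) (s i).
  exists (FEq (TAdd (TAdd t1 t2) (TPar _ (c 0 i))) (TZero M _)).
  by apply/funext => z /=; rewrite E1 E2.
move=> /H; congr definable; apply/funext => x; congr (exists y, _).
apply/funext => y; apply: eq_forall => i; congr (_ + _ + _ = 0).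
  by apply: eq_bigr => j _; rewrite row_mxEl.
by apply: eq_bigr => j _; rewrite row_mxEr.
Qed.

(** Any point of [P] may replace the base point chosen in [direction]. *)
Lemma directionP n (P : set 'rV[M]_n) p d :
  affine P -> P p -> direction P d <-> P (p + d).
Proof.
move=> aP Pp; have Pq : P (xget 0 P) by case: xgetP => [y _ //|/(_ p)].
split=> [[x Px <-]|Pd].
  have := aP _ _ _ Px Pq Pp; congr P; zmod.
exists (p + d - p + xget 0 P); last by zmod.
exact: aP.
Qed.

Lemma direction_subgrp n (P : set 'rV[M]_n) :
  affine P -> P !=set0 -> subgrp (direction P).
Proof.
move=> aP [p Pp]; split; first by apply/(directionP _ aP Pp); rewrite addr0.
move=> x y /(directionP _ aP Pp) Px /(directionP _ aP Pp) Py.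
apply/(directionP _ aP Pp).
by have := aP _ _ _ Px Py Pp; congr P; zmod.
Qed.

Lemma directionB n (P : set 'rV[M]_n) x y :
  affine P -> P x -> P y -> direction P (x - y).
Proof.
move=> aP Px Py; apply/(directionP _ aP Py).
by have <- : x = y + (x - y) by zmod.
Qed.

Lemma directionE n (P : set 'rV[M]_n) x y :
  affine P -> P x -> direction P (y - x) -> P y.
Proof.
by move=> aP Px /(directionP _ aP Px); have -> : x + (y - x) = y by zmod.
Qed.

Lemma pp_direction n (P : set 'rV[M]_n) :
  pp P -> P !=set0 -> pp (direction P).
Proof.
move=> ppP [p Pp]; have aP := pp_affine ppP.
have := pp_shift p ppP; congr pp; apply/funext => d /=.
rewrite addrC; apply/propext; split=> [/(directionP _ aP Pp)|] //.
by move=> /(directionP _ aP Pp).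
Qed.

Lemma direction_sub n (P Q : set 'rV[M]_n) : affine P -> Q !=set0 ->
  affine Q -> Q `<=` P -> direction Q `<=` direction P.
Proof.
move=> aP [q Qq] aQ QP d /(directionP _ aQ Qq) /QP.
by move=> /(directionP _ aP (QP _ Qq)).
Qed.

Lemma direction_coset n (N : set 'rV[M]_n) a : subgrp N ->
  direction [set x | N (x - a)] = N.
Proof.
move=> sN; have aN : affine [set x | N (x - a)].
  move=> x y z /= Nx Ny Nz; have := subgrpD sN (sN.2 _ _ Nx Ny) Nz.
  by congr N; zmod.
have Na : [set x | N (x - a)] a by rewrite /= subrr; exact: sN.1.
apply/funext => d; apply/propext; rewrite (directionP d aN Na) /=.
by have -> : a + d - a = d by zmod.
Qed.

Lemma fin_index_affine n (P N : set 'rV[M]_n) : affine P ->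
  fin_index (direction P) N -> fin_index P N.
Proof.
move=> aP [l lP]; have [[p Pp]|P0] := pselect (P !=set0); last first.
  by exists l => x Px; case: P0; exists x.
exists [seq p + a | a <- l] => x Px.
have [a al Na] := lP _ (directionB aP Px Pp).
by exists (p + a); [exact: map_f|congr N: Na; zmod].
Qed.

Lemma coset_iso n (N : set 'rV[M]_n) a b : pp N ->
  pp_iso [set x | N (x - a)] [set x | N (x - b)].
Proof.
move=> ppN; exists (fun x => x - a + b); split.
  split=> [x Nx /=|x y _ _ e|y /= Ny]; first by rewrite addrK.
    by rewrite -(subrK a x) -(subrK a y); congr (_ + _); apply: (addIr b).
  by exists (y - b + a); rewrite /= ?addrK ?subrK.
(* The graph is the diagonal translated by (a, b) and restricted to the first coset; parameters in
   pp-formulas make the translation legitimate. *)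
have := ppI (pp_sub (lshift n) (pp_coset a ppN))
  (pp_shift (row_mx (- a) (- b))
    (forall_via (@ppI R M) (@ppT R M) (fun i => pp_diag M (lshift n i) (@rshift n n i)))).
congr pp; apply/seteqP; split=> z /=.
  rewrite -/(coord (lshift n) z) coord_lshift => -[Nz E].
  exists (lsubmx z) => //; rewrite -[RHS]hsubmxK; congr row_mx.
  apply/rowP => i; have := E i; rewrite -{1 2}[z]hsubmxK add_row_mx.
  by rewrite row_mxEl row_mxEr !mxE => ->; rewrite subrK.
move=> [x Nx <-]; split.
  by rewrite -/(coord (lshift n) _) coord_lshift row_mxKl.
by move=> i; rewrite add_row_mx row_mxEl row_mxEr !mxE addrK.
Qed.

End PPSets.

(** * Simple functions *)

Section SimpleFunctions.
Variable T : Type.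
Implicit Types (A B : set T) (C : set T -> Prop) (f g : T -> int).

Definition ind A x : int := `[< A x >]%:R.

Definition simple (s : seq (int * set T)) x : int := \sum_(p <- s) p.1 * ind p.2 x.

Definition simple_in C f :=
  exists s, (forall p, p \in s -> C p.2) /\ f =1 simple s.

Definition block A (Bs : seq (set T)) : set T :=
  [set x | A x /\ forall B, B \in Bs -> ~ B x].

Lemma ind1 A x : A x -> ind A x = 1. Proof. by move=> Ax; rewrite /ind asboolT. Qed.
Lemma ind0 A x : ~ A x -> ind A x = 0. Proof. by move=> Ax; rewrite /ind asboolF. Qed.

Lemma indI A B x : ind (A `&` B) x = ind A x * ind B x.
Proof.
have [Ax|Ax] := pselect (A x); last by rewrite (ind0 Ax) mul0r ind0 // => -[].
rewrite (ind1 Ax) mul1r; have [Bx|Bx] := pselect (B x); first by rewrite !ind1.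
by rewrite (ind0 Bx) ind0 // => -[].
Qed.

Lemma indC A x : ind (~` A) x = 1 - ind A x.
Proof.
have [Ax|Ax] := pselect (A x); last by rewrite (ind0 Ax) ind1 ?subr0.
by rewrite (ind1 Ax) ind0 ?subrr.
Qed.

Lemma indU A B x : A `&` B = set0 -> ind (A `|` B) x = ind A x + ind B x.
Proof.
move=> AB0; have [Ax|Ax] := pselect (A x).
  rewrite (ind1 Ax) ind1 ?ind0 ?addr0 //; last by left.
  by move=> Bx; have : (A `&` B) x by []; rewrite AB0.
rewrite (ind0 Ax) add0r; have [Bx|Bx] := pselect (B x).
  by rewrite !ind1 //; right.
by rewrite (ind0 Bx) ind0 // => -[].
Qed.

Lemma simple_nil x : simple [::] x = 0. Proof. exact: big_nil. Qed.

Lemma simple_cons p s x : simple (p :: s) x = p.1 * ind p.2 x + simple s x.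
Proof. exact: big_cons. Qed.

Lemma simple_cat s t x : simple (s ++ t) x = simple s x + simple t x.
Proof. exact: big_cat. Qed.

Lemma simple_in_eq C f g : f =1 g -> simple_in C f -> simple_in C g.
Proof. by move=> fg [s [sC sE]]; exists s; split=> // x; rewrite -fg. Qed.

Lemma simple_in0 C : simple_in C (fun=> 0).
Proof. by exists [::]; split=> // x; rewrite simple_nil. Qed.

Lemma simple_in_ind C A : C A -> simple_in C (ind A).
Proof.
move=> CA; exists [:: (1, A)]; split=> [p|x]; first by rewrite inE => /eqP->.
by rewrite simple_cons simple_nil addr0 mul1r.
Qed.

Lemma simple_inD C f g :
  simple_in C f -> simple_in C g -> simple_in C (fun x => f x + g x).
Proof.
move=> [s [sC sE]] [t [tC tE]]; exists (s ++ t); split=> [p|x].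
  by rewrite mem_cat => /orP[/sC|/tC].
by rewrite simple_cat sE tE.
Qed.

Lemma simple_inZ C f c : simple_in C f -> simple_in C (fun x => c * f x).
Proof.
move=> [s [sC sE]]; exists [seq (c * p.1, p.2) | p <- s]; split.
  by move=> _ /mapP[p /sC pC ->].
move=> x; rewrite sE /simple big_map mulr_sumr.
by apply: eq_bigr => p _; rewrite mulrA.
Qed.

Lemma simple_inB C f g :
  simple_in C f -> simple_in C g -> simple_in C (fun x => f x - g x).
Proof.
move=> fC gC; apply: simple_in_eq (simple_inD fC (simple_inZ (-1) gC)) => x.
by rewrite mulN1r.
Qed.

Section Meet.
Variable C : set T -> Prop.
Hypothesis CI : forall A B, C A -> C B -> C (A `&` B).

Lemma simple_in_mul_ind A f : C A -> simple_in C f ->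
  simple_in C (fun x => ind A x * f x).
Proof.
move=> CA [s [sC sE]]; exists [seq (p.1, A `&` p.2) | p <- s]; split.
  by move=> _ /mapP[p /sC pC ->]; apply: CI.
move=> x; rewrite sE /simple big_map mulr_sumr.
by apply: eq_bigr => p _; rewrite indI mulrCA.
Qed.

Lemma simple_in_block A Bs : C A -> (forall B, B \in Bs -> C B) ->
  simple_in C (ind (block A Bs)).
Proof.
move=> CA; elim: Bs => [|B Bs IH] BC.
  apply: simple_in_eq (simple_in_ind CA) => x; congr ind.
  by apply/seteqP; split=> [y Ay|y []//]; split.
have CB : C B by apply: BC; rewrite mem_head.
have IH' : simple_in C (ind (block A Bs)).
  by apply: IH => B' B's; apply: BC; rewrite inE B's orbT.
apply: simple_in_eq (simple_inB IH' (simple_in_mul_ind CB IH')) => x.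
have -> : block A (B :: Bs) = ~` B `&` block A Bs.
  apply/seteqP; split=> y.
    move=> [Ay nB]; split; first by apply: nB; rewrite mem_head.
    by split=> // B' B's; apply: nB; rewrite inE B's orbT.
  by move=> [nB [Ay nBs]]; split=> // B'; rewrite inE => /orP[/eqP->|/nBs].
by rewrite indI indC mulrBl mul1r.
Qed.

Hypothesis CT : C setT.

(** Peel off the first set: on it [h] is replaced by its shift by the coefficient, off it [h] stays,
    and the indicator of the set glues the two. The induction must therefore run over all [h]. *)
Lemma simple_in_comp (h : int -> int) f :
  simple_in C f -> simple_in C (fun x => h (f x)).
Proof.
move=> [s [sC sE]].
suff H : simple_in C (fun x => h (simple s x)).
  by apply: simple_in_eq H => x; rewrite -sE.
elim: s sC {sE f} h => [|p s IH] sC h.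
  apply: simple_in_eq (simple_inZ (h 0) (simple_in_ind CT)) => x.
  by rewrite ind1 // simple_nil mulr1.
have pC : C p.2 by apply: sC; rewrite mem_head.
have {}IH h' : simple_in C (fun x => h' (simple s x)).
  by apply: IH => q qs; apply: sC; rewrite inE qs orbT.
apply: simple_in_eq (simple_inD (simple_in_mul_ind pC
  (simple_inB (IH (fun c => h (p.1 + c))) (IH h))) (IH h)) => x.
rewrite simple_cons; have [px|px] := pselect (p.2 x).
  by rewrite ind1 // mul1r mulr1 subrK.
by rewrite ind0 // mul0r mulr0 !add0r.
Qed.

Lemma simple_in_indU (I : eqType) (r : seq I) (A : I -> set T) :
  (forall i, i \in r -> simple_in C (ind (A i))) ->
  simple_in C (ind [set x | exists2 i, i \in r & A i x]).
Proof.
elim: r => [|i r IH] rC.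
  apply: simple_in_eq (simple_in0 C) => x; rewrite ind0 //.
  by move=> [? //].
have iC := rC i (mem_head i r).
have {}IH := IH (fun j jr => rC j (mem_behead (s := i :: r) jr)).
apply: simple_in_eq (simple_in_comp (fun c => (c != 0)%:R) (simple_inD iC IH)) => x.
have [H|H] := pselect ((exists2 j, j \in r & A j x)).
  rewrite [X in _ + X]ind1 // [RHS]ind1; last first.
    by case: H => j jr Aj; exists j; rewrite // inE jr orbT.
  by rewrite /ind; case: asbool.
rewrite [X in _ + X]ind0 // addr0; have [Ax|Ax] := pselect (A i x).
  by rewrite !ind1 //; exists i; rewrite ?mem_head.
rewrite !ind0 // => -[j]; rewrite inE => /orP[/eqP->//|jr Aj].
by apply: H; exists j.
Qed.

(** The way back from functions to sets: a block records which sets of a presentation contain the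
    point, and this determines the value of [f]. Inside the first set the prescribed values [H] are
    shifted by its coefficient. *)
Lemma simple_in_blocks f (H : set int) : simple_in C f ->
  exists bs : seq (set T * seq (set T)),
    (forall b, b \in bs -> C b.1 /\ forall B, B \in b.2 -> C B) /\
    forall x, H (f x) <-> exists2 b, b \in bs & block b.1 b.2 x.
Proof.
move=> [s [sC sE]].
suff [bs [bsC bsP]] : exists bs : seq (set T * seq (set T)),
    (forall b, b \in bs -> C b.1 /\ forall B, B \in b.2 -> C B) /\
    forall x, H (simple s x) <-> exists2 b, b \in bs & block b.1 b.2 x.
  by exists bs; split=> // x; rewrite sE.
elim: s sC H {sE} => [|p s IH] sC H.
  have [H0|H0] := pselect (H 0).
    exists [:: (setT, [::])]; split=> [b|x]; first by rewrite inE => /eqP->; split.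
    rewrite simple_nil; split=> // _; exists (setT, [::]); [exact: mem_head|by split].
  by exists [::]; split=> // x; rewrite simple_nil; split=> // -[].
have pC : C p.2 by apply: sC; rewrite mem_head.
have {}IH H' := IH (fun q qs => sC q (mem_behead (s := p :: s) qs)) H'.
have [bs [bsC bsP]] := IH [set c | H (p.1 + c)].
have [bs' [bsC' bsP']] := IH H.
exists ([seq (p.2 `&` b.1, b.2) | b <- bs] ++ [seq (b.1, p.2 :: b.2) | b <- bs']).
split=> [b|x].
  rewrite mem_cat => /orP[/mapP[b' /bsC[C1 C2] ->]|/mapP[b' /bsC'[C1 C2] ->]] /=.
    by split=> //; apply: CI.
  by split=> // B; rewrite inE => /orP[/eqP->|/C2].
rewrite simple_cons; have [px|px] := pselect (p.2 x).
  rewrite ind1 // mulr1; split=> [/bsP[b bbs [b1 b2]]|[b]].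
    exists (p.2 `&` b.1, b.2); last by split.
    by rewrite mem_cat map_f.
  rewrite mem_cat => /orP[/mapP[b' b's ->] [/= [_ b1] b2]|/mapP[b' b's ->] [/= b1 b2]].
    by apply/bsP; exists b'.
  by case: (b2 p.2) => //; rewrite mem_head.
rewrite ind0 // mulr0 add0r; split=> [/bsP'[b bbs [b1 b2]]|[b]].
  exists (b.1, p.2 :: b.2).
    by rewrite mem_cat; apply/orP; right; apply/mapP; exists b.
  by split=> //= B; rewrite inE => /orP[/eqP->|/b2].
rewrite mem_cat => /orP[/mapP[b' b's ->] [/= [] //]|/mapP[b' b's ->] [/= b1 b2]].
apply/bsP'; exists b' => //; split=> // B Bb; apply: b2.
by rewrite inE Bb orbT.
Qed.

End Meet.
End SimpleFunctions.

(** * Valuations on pp-sets *)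

(** The relation need not be antisymmetric, so maximality is meant up to mutual comparability. *)
Lemma exists_maximal (T : eqType) (r : T -> T -> Prop) (s : seq T) :
  (forall x y z, r x y -> r y z -> r x z) -> s != [::] ->
  exists2 x, x \in s & forall y, y \in s -> r x y -> r y x.
Proof.
move=> rT; elim: s => // a [|b s] IH _.
  by exists a; rewrite ?mem_head // => y; rewrite inE => /eqP->.
have [//|x xs xmax] := IH.
have [xa|xa] := pselect (r x a).
  exists a; rewrite ?mem_head // => y; rewrite in_cons => /orP[/eqP->//|ys] ay.
  exact: rT _ _ _ (xmax y ys (rT _ _ _ xa ay)) xa.
exists x; first by rewrite in_cons xs orbT.
by move=> y; rewrite in_cons => /orP[/eqP->//|]; apply: xmax.
Qed.

Section Neumann.
Variables (R : pzRingType) (M : lmodType R^c) (n : nat).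
Implicit Types (P Q N : set 'rV[M]_n) (s : seq (set 'rV[M]_n)).

Definition direction_meet s : set 'rV[M]_n :=
  [set d | forall P, P \in s -> direction P d].

Lemma direction_meet_cons P s :
  direction_meet (P :: s) = direction P `&` direction_meet s.
Proof.
apply/seteqP; split=> d /=.
  by move=> H; split=> [|Q Qs]; apply: H; rewrite inE ?eqxx ?Qs ?orbT.
by move=> [Pd sd] Q; rewrite inE => /orP[/eqP->|/sd].
Qed.

Lemma direction_meet_nil : direction_meet [::] = setT.
Proof. by apply/seteqP; split. Qed.

Lemma direction_meet_subgrp s :
  (forall P, P \in s -> affine P /\ P !=set0) -> subgrp (direction_meet s).
Proof.
elim: s => [|P s IH] sP; first by rewrite direction_meet_nil; apply: subgrpT.
rewrite direction_meet_cons; apply: subgrpI.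
  by have [] := sP P (mem_head _ _); apply: direction_subgrp.
by apply: IH => Q Qs; apply: sP; rewrite inE Qs orbT.
Qed.

Lemma direction_meet_pp s :
  (forall P, P \in s -> pp P /\ P !=set0) -> pp (direction_meet s).
Proof.
elim: s => [|P s IH] sP; first by rewrite direction_meet_nil; apply: ppT.
rewrite direction_meet_cons; apply: ppI.
  by have [] := sP P (mem_head _ _); apply: pp_direction.
by apply: IH => Q Qs; apply: sP; rewrite inE Qs orbT.
Qed.

Lemma direction_meet_fin_index G s :
  (forall P, P \in s -> [/\ affine P, P !=set0 & fin_index G (direction P)]) ->
  fin_index G (direction_meet s).
Proof.
elim: s => [|P s IH] sP.
  by apply: (@fin_index_subr _ _ G); [rewrite direction_meet_nil|exact: fin_index_refl].
have [aP P0 GP] := sP P (mem_head _ _).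
have sP' Q : Q \in s -> [/\ affine Q, Q !=set0 & fin_index G (direction Q)].
  by move=> Qs; apply: sP; rewrite inE Qs orbT.
rewrite direction_meet_cons; apply: fin_indexI => //.
- exact: direction_subgrp.
- by apply: direction_meet_subgrp => Q /sP'[].
- exact: IH.
Qed.

(** Translation by -z turns each [Q] into a coset of its direction. Empty sets are dropped first,
    since their direction is empty and not a subgroup. *)
Lemma neumann_cosets N s z : subgrp N -> (forall Q, Q \in s -> affine Q) ->
  (forall h, N h -> exists2 Q, Q \in s & Q (z + h)) ->
  exists Q, [/\ Q \in s, Q !=set0 & fin_index N (direction Q)].
Proof.
move=> sN sQ cov.
pose s' := [seq Q <- s | `[< Q !=set0 >]].
have s'P Q : Q \in s' -> [/\ Q \in s, affine Q & Q !=set0].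
  by rewrite mem_filter => /andP[/asboolP Q0 Qs]; split=> //; apply: sQ.
pose c := [seq ([:: xget 0 Q - z], direction Q) | Q <- s'].
have [_ /mapP[Q /s'P[Qs _ Q0] ->]|x Nx|_ /mapP[Q Qs ->] fQ] := @neumann _ N c sN.
- by apply: direction_subgrp => //; apply: sQ.
- have [Q Qs Qx] := cov x Nx; have Q0 : Q !=set0 by exists (z + x).
  exists ([:: xget 0 Q - z], direction Q).
    by apply: map_f; rewrite mem_filter Qs andbT; apply/asboolP.
  exists (xget 0 Q - z); first exact: mem_head.
  have Qg : Q (xget 0 Q) by case: xgetP => [y _ //|/(_ (z + x))].
  by have := directionB (sQ _ Qs) Qx Qg; congr direction; zmod.
by have [? ? ?] := s'P _ Qs; exists Q.
Qed.

Section Valuation.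
Variables (S : zmodType) (mu : set 'rV[M]_n -> S).
Hypothesis mu0 : mu set0 = 0.
Hypothesis mu_transversal : forall P N l, pp P -> P !=set0 -> pp N ->
  subgrp N -> N `<=` direction P -> transversal P N l -> mu P = mu N *+ size l.

Definition valuation (s : seq (int * set 'rV[M]_n)) : S :=
  \sum_(p <- s) mu p.2 *~ p.1.

(** Induction on the length: the terms of one maximal commensurability class form a function that
    already vanishes identically, and so does the shorter rest. *)
Let valuation_nonempty_eq0 (s : seq (int * set 'rV[M]_n)) :
  (forall p, p \in s -> pp p.2 /\ p.2 !=set0) -> simple s =1 (fun=> 0) ->
  valuation s = 0.
Proof.
move: {2}(size s) (leqnn (size s)) => m; elim: m s => [|m IH] s.
  by rewrite leqn0 => /nilP-> _ _; rewrite /valuation big_nil.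
move=> szs sP s0; have [->|s_neq0] := eqVneq s [::]; first by rewrite /valuation big_nil.
(* The direction of [p] is contained in that of [q] up to finite index. *)
pose r (p q : int * set 'rV[M]_n) := fin_index (direction p.2) (direction q.2).
have [p ps pmax] : exists2 p, p \in s & forall q, q \in s -> r p q -> r q p.
  by apply: exists_maximal => // ? ? ?; apply: fin_index_trans.
have sA q : q \in s -> affine q.2 by move=> /sP[/pp_affine].
pose K := [seq q <- s | `[< r p q >]].
pose K' := [seq q <- s | ~~ `[< r p q >]].
have KP q : q \in K -> [/\ q \in s, r p q & r q p].
  by rewrite mem_filter => /andP[/asboolP pq qs]; split=> //; apply: pmax.
(* All directions in [K] are commensurable, so [N] has finite index in each, and every set of [K] is
   a finite union of cosets of [N]. *)
pose N := direction_meet (map snd K).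
have NK q : q \in K -> N `<=` direction q.2.
  by move=> qK d; apply; apply: map_f.
have sN : subgrp N.
  apply: direction_meet_subgrp => _ /mapP[q /KP[qs _ _] ->].
  by have [_ ?] := sP q qs; split=> //; apply: sA.
have ppN : pp N.
  by apply: direction_meet_pp => _ /mapP[q /KP[qs _ _] ->]; apply: sP.
have fN : fin_index (direction p.2) N.
  apply: direction_meet_fin_index => _ /mapP[q /KP[qs pq _] ->].
  by have [_ ?] := sP q qs; split=> //; apply: sA.
pose U := [set x | exists2 q, q \in K & q.2 x].
have fU : fin_index U N.
  have [lU HlU] : exists lU : (int * set 'rV[M]_n) -> seq 'rV[M]_n, forall q,
      q \in K -> forall x, q.2 x -> exists2 a, a \in lU q & N (x - a).
    have H q : exists l : seq 'rV[M]_n,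
      q \in K -> forall x, q.2 x -> exists2 a, a \in l & N (x - a).
      have [qK|] := boolP (q \in K); last by exists [::].
      have [qs _ qp] := KP q qK.
      have [l lP] := fin_index_affine (sA q qs) (fin_index_trans qp fN).
      by exists l.
    by have [f fP] := choice H; exists f.
  exists (flatten [seq lU q | q <- K]) => x [q qK qx].
  have [a al Na] := HlU q qK x qx; exists a => //.
  by apply/flattenP; exists (lU q) => //; apply: map_f.
have [l lP] := transversal_exists sN fU; have [ul lU lcov lsep] := lP.
have invK q x y : q \in K -> N (y - x) -> q.2 x -> q.2 y.
  by move=> qK Nyx qx; have [qs _ _] := KP q qK; apply: (directionE (sA q qs) qx);
    apply: (NK q).
have invS x y : N (y - x) -> simple K y = simple K x.
  move=> Nyx; apply: eq_big_seq => q qK; congr (_ * _%:R); congr nat_of_bool.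
  apply: asbool_equiv_eq; split; last exact: invK.
  exact: (invK q y x qK (subgrp_subC sN Nyx)).
have sKK' x : simple s x = simple K x + simple K' x.
  by rewrite /simple [LHS](bigID (fun q => `[< r p q >])) /= !big_filter.
(* The [K]-part is constant on a + N. If it were nonzero, the sets of [K'] would have to cover that
   coset; by Neumann one of them would then have finite index in [N] and belong to [K]. *)
have Kl a : a \in l -> simple K a = 0.
  move=> al; apply: contrapT => Ka.
  have [||Q [/mapP[q qK' ->] q0 fq]] := @neumann_cosets N (map snd K') a sN.
  - by move=> _ /mapP[q + ->]; rewrite mem_filter => /andP[_ /sA].
  - move=> h Nh; apply: contrapT => ncov; apply: Ka.
    rewrite -(@invS _ (a + h)); last by have -> : a + h - a = h by zmod.
    have := s0 (a + h); rewrite sKK' [X in _ + X](_ : _ = 0) ?addr0 //.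
    rewrite /simple big1_seq // => q /andP[_ qK'].
    rewrite ind0 ?mulr0 // => qah; apply: ncov; exists q.2 => //.
    exact: map_f.
  move: qK'; rewrite mem_filter => /andP[/negP + qs]; apply; apply/asboolP.
  exact: fin_index_trans fN fq.
have K0 x : simple K x = 0.
  have [Ux|nU] := pselect (U x).
    by have [a al Na] := lcov x Ux; rewrite (invS a) ?Kl.
  rewrite /simple big1_seq // => q /andP[_ qK].
  by rewrite ind0 ?mulr0 // => qx; apply: nU; exists q.
(* Each [mu q.2] is [mu N] times the number of representatives in [q.2]; exchanging the sums leaves
   the values of the [K]-part at the representatives. *)
have muK : valuation K = 0.
  have -> : valuation K = \sum_(q <- K) \sum_(a <- l) mu N *~ (q.1 * ind q.2 a).
    apply: eq_big_seq => q qK; have [qs _ _] := KP q qK; have [ppq q0] := sP q qs.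
    have lq : transversal q.2 N [seq a <- l | `[< q.2 a >]].
      split=> [|a|x qx|a b]; first exact: filter_uniq.
      - by rewrite mem_filter => /andP[/asboolP].
      - have Ux : U x by exists q.
        have [a al Na] := lcov x Ux; exists a => //.
        rewrite mem_filter al andbT; apply/asboolP.
        exact: (invK q x a qK (subgrp_subC sN Na)).
      - by rewrite !mem_filter => /andP[_ al] /andP[_ bl]; apply: lsep.
    rewrite (mu_transversal ppq q0 ppN sN (NK q qK) lq) -mulrz_sumr -mulr_sumr.
    suff -> : \sum_(a <- l) ind q.2 a = (size [seq a <- l | `[< q.2 a >]])%:Z.
      by rewrite mulrC mulrzA.
    rewrite size_filter -sum1_count /ind -natr_sum natz.
    by congr Posz; rewrite [RHS]big_mkcond; apply: eq_bigr => a _; case: asbool.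
  rewrite exchange_big /= big1_seq // => a /andP[_ al].
  by rewrite -mulrz_sumr -/(simple K a) Kl // mulr0z.
(* The maximal [p] itself lies in [K]. *)
have szK' : (size K' <= m)%N.
  rewrite -ltnS; apply: leq_trans szs; rewrite size_filter ltn_neqAle count_size andbT.
  apply/negP; rewrite -all_count => /allP /(_ p ps) /negP; apply.
  by apply/asboolP; apply: fin_index_refl.
have K'0 : valuation K' = 0.
  apply: IH => // [q|x]; first by rewrite mem_filter => /andP[_ /sP].
  by have := s0 x; rewrite sKK' K0 add0r.
have -> : valuation s = valuation K + valuation K'.
  by rewrite /valuation [LHS](bigID (fun q => `[< r p q >])) /= !big_filter.
by rewrite muK K'0 addr0.
Qed.

Lemma valuation_eq0 (s : seq (int * set 'rV[M]_n)) :
  (forall p, p \in s -> pp p.2) -> simple s =1 (fun=> 0) -> valuation s = 0.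
Proof.
move=> sP s0; pose s' := [seq p <- s | `[< p.2 !=set0 >]].
have E0 (p : int * set 'rV[M]_n) : ~~ `[< p.2 !=set0 >] -> p.2 = set0.
  by move=> /asboolPn H; apply/seteqP; split=> // x px; apply: H; exists x.
have <- : valuation s' = valuation s.
  rewrite /valuation big_filter big_mkcond; apply: eq_bigr => p _.
  by case: ifPn => // /E0 ->; rewrite mu0 mul0rz.
apply: valuation_nonempty_eq0 => [p|x].
  by rewrite mem_filter => /andP[/asboolP p0 /sP].
rewrite -(s0 x) /simple big_filter big_mkcond; apply: eq_bigr => p _.
by case: ifPn => // /E0 ->; rewrite ind0 ?mulr0.
Qed.

End Valuation.
End Neumann.

(** * Quantifier elimination *)

Section QuantifierElimination.
Variables (R : pzRingType) (M : lmodType R^c).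

Definition pp_simple n (f : 'rV[M]_n -> int) : Prop := simple_in (@pp R M n) f.

Section Fibers.
Variables m n : nat.
Implicit Types (P Q : set 'rV[M]_(m + n)) (x : 'rV[M]_m) (y d : 'rV[M]_n).

Definition fiber P x : set 'rV[M]_n := [set y | P (row_mx x y)].

(* The nonempty fibres of an affine set all have the same direction. *)
Definition fiber0 P := fiber P (lsubmx (xget 0 P)).

Lemma fiber_affine P x : affine P -> affine (fiber P x).
Proof.
move=> aP y z t Py Pz Pt; have := aP _ _ _ Py Pz Pt.
by rewrite /fiber /= opp_row_mx !add_row_mx subrr add0r.
Qed.

Lemma fiber0_neq0 P : P !=set0 -> fiber0 P !=set0.
Proof.
move=> [p Pp]; exists (rsubmx (xget 0 P)); rewrite /fiber0 /fiber /= hsubmxK.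
by case: xgetP => [y _ //|/(_ p)].
Qed.

Lemma fiber0P P x y d : affine P -> P (row_mx x y) ->
  direction (fiber0 P) d <-> P (row_mx x (y + d)).
Proof.
move=> aP Pxy; have P0 : P !=set0 by exists (row_mx x y).
have [y0 Py0] := fiber0_neq0 P0.
have aF : affine (fiber0 P) by apply: fiber_affine.
rewrite (directionP d aF Py0) /fiber0 /fiber /=.
have Py0' : P (row_mx (lsubmx (xget 0 P)) y0) by [].
split=> [Pd|Pd].
  have := aP _ _ _ Pd Py0' Pxy; congr P.
  by rewrite opp_row_mx !add_row_mx; congr row_mx; zmod.
have := aP _ _ _ Pd Pxy Py0'; congr P.
by rewrite opp_row_mx !add_row_mx; congr row_mx; zmod.
Qed.

Lemma fiber_direction Q x : affine Q -> fiber Q x !=set0 ->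
  direction (fiber Q x) = direction (fiber0 Q).
Proof.
move=> aQ [y Qy]; apply/funext => d; apply/propext.
rewrite (fiber0P d aQ Qy); exact: (directionP d (fiber_affine (x := x) aQ) Qy).
Qed.

(* By Neumann's lemma the Q of infinite fibre index in P do not matter; for
   the others the fibre consists of finitely many cosets of a subgroup N, and
   the number of these cosets that the Q leave uncovered is a linear
   combination of indicators of projections. *)
Lemma pp_simple_project_block P Qs : pp P -> (forall Q, Q \in Qs -> pp Q) ->
  pp_simple (ind [set x | exists y, block P Qs (row_mx x y)]).
Proof.
move=> ppP ppQs; have [P0|P0] := pselect (P !=set0); last first.
  apply: simple_in_eq (simple_in0 _) => x; rewrite ind0 // => -[y [Py _]].
  by apply: P0; exists (row_mx x y).
have aP := pp_affine ppP.
(* After intersecting with [P] and dropping empty sets, every [Q] lies in [P] and [fiber0 Q] is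
   nonempty. *)
pose Qs' := [seq P `&` Q | Q <- Qs & `[< (P `&` Q) !=set0 >]].
have Qs'P Q : Q \in Qs' -> [/\ pp Q, affine Q, Q !=set0 & Q `<=` P].
  move=> /mapP[Q1]; rewrite mem_filter => /andP[/asboolP Q0 /ppQs ppQ] ->.
  have ppPQ := ppI ppP ppQ.
  by split=> //; exact: pp_affine.
have -> : block P Qs = block P Qs'.
  apply/seteqP; split=> z [Pz nQ]; split=> // Q.
    by move=> /mapP[Q1]; rewrite mem_filter => /andP[_ /nQ nQ1] -> [].
  move=> Qs_Q Qz; apply: (nQ (P `&` Q)) => //; apply: map_f.
  by rewrite mem_filter Qs_Q andbT; apply/asboolP; exists z.
move: Qs' Qs'P => {}Qs QsP {ppQs}.
pose G := direction (fiber0 P).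
have sG : subgrp G by apply: direction_subgrp; [exact: fiber_affine|exact: fiber0_neq0].
pose Qf := [seq Q <- Qs | `[< fin_index G (direction (fiber0 Q)) >]].
have QfP Q : Q \in Qf -> Q \in Qs /\ fin_index G (direction (fiber0 Q)).
  by rewrite mem_filter => /andP[/asboolP].
pose N := direction_meet (map fiber0 (P :: Qf)).
have HN Q : Q \in P :: Qf ->
    [/\ affine (fiber0 Q), fiber0 Q !=set0 & fin_index G (direction (fiber0 Q))].
  rewrite in_cons => /orP[/eqP->|/QfP[/QsP[_ aQ Q0 _] fQ]].
    by split; [exact: fiber_affine|exact: fiber0_neq0|exact: fin_index_refl].
  by split=> //; [exact: fiber_affine|exact: fiber0_neq0].
have sN : subgrp N.
  by apply: direction_meet_subgrp => _ /mapP[Q /HN[] + + _ ->].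
have fN : fin_index G N.
  by apply: direction_meet_fin_index => _ /mapP[Q /HN[] + + + ->].
have NP d : N d -> G d by apply; exact: mem_head.
have NQ Q d : Q \in Qf -> N d -> direction (fiber0 Q) d.
  by move=> QQ; apply; apply: map_f; rewrite in_cons QQ orbT.
have [l lP] := transversal_exists sN fN; have [ul lG lcov lsep] := lP.
(* The pp-subsets of [P] whose fibres are unions of cosets of [N]: for these, counting cosets in a
   fibre makes sense. *)
pose C A := [/\ pp A, A `<=` P &
  forall x y y', N (y' - y) -> A (row_mx x y) -> A (row_mx x y')].
have CI A B : C A -> C B -> C (A `&` B).
  move=> [ppA AP iA] [ppB BP iB]; split; first exact: ppI.
    by move=> z [/AP].
  by move=> x y y' Ny [Ay By]; split; [apply: iA Ay|apply: iB By].
have CP : C P.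
  split=> // x y y' Ny Py; have /NP := Ny.
  by move=> /(fiber0P _ aP Py); have -> : y + (y' - y) = y' by zmod.
have CQ Q : Q \in Qf -> C Q.
  move=> QQ; have [QQs _] := QfP _ QQ; have [ppQ aQ _ QP] := QsP _ QQs.
  split=> // x y y' Ny Qy; have /(NQ _ _ QQ) := Ny.
  by move=> /(fiber0P _ aQ Qy); have -> : y + (y' - y) = y' by zmod.
have [s [sC sE]] := simple_in_block CI CP CQ.
(* The number of cosets of [N] in any nonempty fibre of [A]. *)
pose k (A : set 'rV[M]_(m + n)) := count (fun a => `[< direction (fiber0 A) a >]) l.
(* The points y + a represent the cosets of [N] in the fibre of [P]. Comparing [y] with a point [b]
   of the fibre of [A] shifts the representatives by y - b in [G], which leaves the count
   unchanged. *)
have countA A x y : C A -> P (row_mx x y) ->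
    \sum_(a <- l) ind A (row_mx x (y + a))
    = ind [set x | exists y, A (row_mx x y)] x * (k A)%:Z.
  move=> [ppA AP iA] Py; have [[b Ab]|nA] := pselect (exists b, A (row_mx x b)).
    rewrite ind1 ?mul1r; last by exists b.
    have Gt : G (y - b).
      apply/(fiber0P _ aP (AP _ Ab)).
      by have -> : b + (y - b) = y by zmod.
    have := count_transversal_shift (A := direction (fiber0 A)) sG sN lP Gt.
    have dA d : direction (fiber0 A) d <-> A (row_mx x (b + d)).
      exact: fiber0P (pp_affine ppA) Ab.
    rewrite -/(k A) => <- => [|c d Ncd /dA Ac]; last first.
      apply/dA; apply: iA Ac; have := subgrp_subC sN Ncd; congr N; zmod.
    rewrite -sum1_count /ind -natr_sum natz; congr Posz.
    rewrite [RHS]big_mkcond; apply: eq_bigr => a _.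
    have -> : row_mx x (y + a) = row_mx x (b + (y - b + a)) by congr row_mx; zmod.
    by rewrite (asbool_equiv_eq (dA _)); case: asbool.
  rewrite [X in _ = X * _]ind0 // mul0r big1 // => a _; rewrite ind0 // => Aa.
  by apply: nA; exists (y + a).
(* The number of cosets of [N] in the fibre over [x] that avoid [Qf]; it is written without
   reference to a point of the fibre, hence visibly simple. *)
pose psi x := \sum_(p <- s) p.1 * (ind [set x | exists y, p.2 (row_mx x y)] x * (k p.2)%:Z).
have psiE x y : P (row_mx x y) ->
    psi x = \sum_(a <- l) ind (block P Qf) (row_mx x (y + a)).
  move=> Py; under [RHS]eq_bigr do rewrite sE.
  rewrite /simple exchange_big /=; apply: eq_big_seq => p /sC Cp.
  by rewrite -mulr_sumr (countA _ _ _ Cp Py).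
have psi_simple : pp_simple psi.
  exists [seq (p.1 * (k p.2)%:Z, [set x | exists y, p.2 (row_mx x y)]) | p <- s].
  split=> [_ /mapP[p /sC[ppp _ _] ->]|x]; first exact: pp_ex.
  by rewrite /simple big_map; apply: eq_bigr => p _; rewrite mulrAC mulrA.
have blockP x y : P (row_mx x y) -> (exists y', block P Qs (row_mx x y')) <->
    exists2 a, a \in l & block P Qf (row_mx x (y + a)).
  move=> Py; split=> [[y' [Py' nQ]]|[a al [Pa nQ]]].
    have Gy' : G (y' - y).
      by apply/(fiber0P _ aP Py); have -> : y + (y' - y) = y' by zmod.
    have [a al Na] := lcov _ Gy'; exists a => //; split.
      by apply/(fiber0P _ aP Py)/lG.
    move=> Q QQ Qa; have [QQs _] := QfP _ QQ; apply: (nQ Q QQs).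
    have [_ _ iQ] := CQ _ QQ; apply: iQ Qa; congr N: Na; zmod.
  (* Were the coset y + a + N covered by the fibres of the remaining [Q], Neumann would put one of
     these into [Qf]. *)
  apply: contrapT => noblock.
  have [||F [/mapP[Q Qin ->] F0 fF]] :=
    @neumann_cosets _ _ _ N [seq fiber Q x | Q <- Qs & Q \notin Qf] (y + a) sN.
  - move=> _ /mapP[Q + ->]; rewrite mem_filter => /andP[_ /QsP[_ aQ _ _]].
    exact: fiber_affine.
  - move=> h Nh; apply: contrapT => nh; apply: noblock; exists (y + a + h).
    have Nh' : N (y + a + h - (y + a)) by congr N: Nh; zmod.
    split; first by have [_ _ iP] := CP; apply: iP Nh' Pa.
    move=> Q QQs Qh; have [QQ|QQ] := boolP (Q \in Qf).
      have [_ _ iQ] := CQ _ QQ; apply: (nQ Q QQ).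
      exact: iQ (subgrp_subC sN Nh') Qh.
    by apply: nh; exists (fiber Q x) => //; apply: map_f; rewrite mem_filter QQ.
  move: Qin; rewrite mem_filter => /andP[/negP + QQs]; apply.
  have [_ aQ _ _] := QsP _ QQs; rewrite fiber_direction // in fF.
  by rewrite mem_filter QQs andbT; apply/asboolP; exact: fin_index_trans fN fF.
(* The projection is the set where the count is nonzero. *)
apply: simple_in_eq (simple_in_comp (@ppI R M m) (@ppT R M m)
  (fun c => (c != 0)%:R) psi_simple) => x /=.
have [[y Py]|nP] := pselect (exists y, P (row_mx x y)); last first.
  rewrite [RHS]ind0; last by move=> [y [Py _]]; apply: nP; exists y.
  rewrite /psi big1_seq ?eqxx // => p /andP[_ /sC[_ AP _]].
  by rewrite ind0 ?mul0r ?mulr0 // => -[y /AP Py]; apply: nP; exists y.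
rewrite (psiE x y Py); have [H|H] := pselect (exists y', block P Qs (row_mx x y')).
  rewrite [RHS]ind1 //; have [a al Ba] := (blockP x y Py).1 H.
  rewrite (big_rem a) //= ind1 // gt_eqF // ltr_pwDl //.
  by apply: sumr_ge0 => b _; rewrite /ind ler0n.
rewrite [RHS]ind0 // big1_seq ?eqxx // => a /andP[_ al].
by rewrite ind0 // => Ba; apply: H; apply/(blockP x y Py); exists a.
Qed.

(** Projection commutes with unions, so it is enough to project the blocks that make up the level
    set of value 1. *)
Lemma pp_simple_project (A : set 'rV[M]_(m + n)) : pp_simple (ind A) ->
  pp_simple (ind [set x | exists y, A (row_mx x y)]).
Proof.
move=> sA.
have [bs [bsP bsE]] := simple_in_blocks (@ppI R M _) (@ppT R M _) [set 1] sA.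
have AE z : A z <-> exists2 b, b \in bs & block b.1 b.2 z.
  rewrite -bsE /=; split=> [|Az]; first exact: ind1.
  by apply: contrapT => nA; move: Az; rewrite ind0.
have -> : [set x | exists y, A (row_mx x y)] =
    [set x | exists2 b, b \in bs & exists y, block b.1 b.2 (row_mx x y)].
  apply/seteqP; split=> x /= [].
    by move=> y /AE[b bbs By]; exists b => //; exists y.
  by move=> b bbs [y By]; exists y; apply/AE; exists b.
apply: simple_in_indU; [exact: ppI|exact: ppT|].
by move=> b /bsP[? ?]; apply: pp_simple_project_block.
Qed.

End Fibers.

Lemma eval_linear (V : Type) (t : term M V) n (s : V -> 'I_n) :
  exists (r : 'I_n -> R) (c : M), forall x : 'rV[M]_n,
    eval (fun v => x 0 (s v)) t = \sum_j rscale (x 0 j) (r j) + c.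
Proof.
elim: t => [v|a||t [r [c E]]|t [r [c E]] u [r' [c' E']]|t [r [c E]] a].
- exists (fun j => (s v == j)%:R), 0 => x /=.
  by rewrite (sum_rscale_delta (fun j => x 0 j)) addr0.
- exists (fun=> 0), a => x /=; rewrite big1 ?add0r // => j _; exact: rscale0.
- exists (fun=> 0), 0 => x /=; rewrite big1 ?add0r // => j _; exact: rscale0.
- exists (fun j => 0 - r j), (- c) => x /=; rewrite E opprD -sumrN.
  by congr (_ + _); apply: eq_bigr => j _; rewrite rscaleB rscale0 sub0r.
- exists (fun j => r j - (0 - r' j)), (c + c') => x /=; rewrite E E' addrACA -big_split.
  congr (_ + _); apply: eq_bigr => j _ /=.
  by rewrite !rscaleB rscale0 sub0r opprK.
- exists (fun j => r j * a), (rscale c a) => x /=; rewrite E rscaleDl.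
  congr (_ + _); rewrite /rscale scaler_sumr; apply: eq_bigr => j _.
  by rewrite scalerA.
Qed.

(** A quantifier changes the type of variables to [option V]; hence the induction ranges over all
    variable types, with [s] assigning coordinates to variables. *)
Lemma pp_simple_holds (V : Type) (f : formula M V) n (s : V -> 'I_n) :
  pp_simple (ind [set x : 'rV[M]_n | holds f (fun v => x 0 (s v))]).
Proof.
elim: f n s => {V} [V t u|V f IH|V f IHf g IHg|V f IH] n s.
- have [r [c E]] := eval_linear t s; have [r' [c' E']] := eval_linear u s.
  apply: simple_in_ind.
  have := @pp_sysP R M n unit void (fun _ j => r j - r' j) (fun _ _ => 0) (fun=> c - c').
  congr pp; apply/funext => x /=; rewrite E E'.
  have S j : rscale (x 0 j) (r j - r' j) = rscale (x 0 j) (r j) - rscale (x 0 j) (r' j).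
    exact: rscaleB.
  have T (y : void -> M) : \sum_j rscale (x 0 j) (r j - r' j)
      + \sum_k rscale (y k) (0 : R) + (c - c')
      = (\sum_j rscale (x 0 j) (r j) + c) - (\sum_j rscale (x 0 j) (r' j) + c').
    rewrite [X in _ + X + _]big1 => [|[]//]; under eq_bigr do rewrite S.
    rewrite sumrB; set a := \sum_j _; set b := \sum_j _; zmod.
  apply/propext; split=> [[y /(_ tt)]|e]; first by rewrite T => /subr0_eq.
  by exists (fun=> 0) => _; rewrite T e subrr.
- apply: simple_in_eq (simple_inB (simple_in_ind (@ppT R M n)) (IH n s)) => x.
  by rewrite ind1 // -indC.
(* The sum of two indicators is 2 exactly on the intersection. *)
- apply: simple_in_eq (simple_in_comp (@ppI R M n) (@ppT R M n)
    (fun c => (c == 2)%:R) (simple_inD (IHf n s) (IHg n s))) => x.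
  rewrite -[RHS]/(ind ([set x | holds f _] `&` [set x | holds g _]) x) indI /ind.
  by case: asbool; case: asbool.
pose s' (o : option V) : 'I_(n + 1) :=
  if o is Some v then lshift 1 (s v) else rshift n ord0.
have E (x : 'rV[M]_n) (y : 'rV[M]_1) :
    (fun o => (row_mx x y) 0 (s' o)) = ext (fun v => x 0 (s v)) (y 0 0).
  by apply/funext => -[v|] /=; rewrite ?row_mxEl ?row_mxEr.
apply: simple_in_eq (pp_simple_project (IH (n + 1)%N s')) => x; congr ind.
apply/seteqP; split=> {}x /= [y]; first by rewrite E => H; exists (y 0 0).
by move=> H; exists (const_mx y); rewrite E mxE.
Qed.

Lemma pp_simple_definable n (A : set 'rV[M]_n) : definable A -> pp_simple (ind A).
Proof. by move=> [f ->]; exact: (pp_simple_holds f id). Qed.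

End QuantifierElimination.

(** * The Euler characteristic *)

Section IndexTransversal.
Variables (R : pzRingType) (M : lmodType R^c) (n : nat).
Implicit Types (P Q N : set 'rV[M]_n).

Lemma coset_eq N x y : subgrp N ->
  [set x + h | h in N] = [set y + h | h in N] <-> N (x - y).
Proof.
move=> sN; split=> [E|Nxy].
  have : [set x + h | h in N] x by exists 0; [exact: sN.1|exact: addr0].
  by rewrite E => -[h Nh <-]; congr N: Nh; zmod.
apply/seteqP; split=> _ [h Nh <-].
  by exists (x - y + h); [exact: subgrpD|zmod].
exists (y - x + h); last by zmod.
by apply: subgrpD => //; apply: subgrp_subC.
Qed.

Lemma card_cosets P N l : affine P -> P !=set0 -> subgrp N ->
  transversal P N l -> (cosets (direction P) N #= `I_(size l))%card.
Proof.
move=> aP [p Pp] sN [ul lP lcov lsep].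
pose F i := [set (l`_i - p) + h | h in N].
have -> : cosets (direction P) N = F @` `I_(size l).
  apply/seteqP; split=> [_ [g Pg <-]|_ [i /= il <-]]; last first.
    by exists (l`_i - p) => //; apply: directionB => //; apply/lP/mem_nth.
  have /lcov[a al Na] : P (p + g) by apply/(directionP _ aP Pp).
  exists (index a l); first by rewrite /= index_mem.
  rewrite /F nth_index //; apply/(coset_eq _ _ sN); apply: subgrp_subC => //.
  by congr N: Na; zmod.
apply: inj_card_eq => i j /set_mem /= il /set_mem /= jl /(coset_eq _ _ sN) Nij.
apply/eqP; rewrite -(nth_uniq 0 il jl ul); apply/eqP.
by apply: lsep; rewrite ?mem_nth //; congr N: Nij; zmod.
Qed.

Lemma pp_index_transversal P Q k : affine P -> P !=set0 -> affine Q -> Q !=set0 ->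
  Q `<=` P -> pp_index P Q k ->
  exists l, transversal P (direction Q) l /\ size l = k.
Proof.
move=> aP P0 aQ Q0 QP; rewrite /pp_index.
have QPd := direction_sub aP Q0 aQ QP.
have -> : direction P `&` direction Q = direction Q by apply/setIidr.
set N := direction Q => PQk; have sN : subgrp N by exact: direction_subgrp.
have fN : fin_index P N.
  apply: fin_index_affine => //; move: PQk.
  rewrite card_eq_sym => /card_set_bijP[f [_ _ fsurj]].
  exists [seq xget 0 (f i) | i <- iota 0 k] => x Px.
  have [i /= ik fi] : exists2 i, `I_k i & f i = [set x + h | h in N].
    by apply: fsurj; exists x.
  exists (xget 0 (f i)); first by apply: map_f; rewrite mem_iota.
  rewrite fi; case: xgetP => [_ -> [h Nh <-]|/(_ x)[]]; last first.
    by exists 0; [exact: sN.1|exact: addr0].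
  by have := subgrpN sN Nh; congr N; zmod.
have [l lP] := transversal_exists sN fN; exists l; split=> //.
apply/card_eq_II; apply: card_eq_trans PQk; rewrite card_eq_sym.
exact: card_cosets.
Qed.

End IndexTransversal.

(** * The valuation with values in the colour ring modulo invariants *)

Section ColourValuation.
Variables (R : pzRingType) (M : lmodType R^c).
Local Notation Q := (colour_ring_mod_invariants M).

Lemma iso_via_neq0 (C : forall k, set 'rV[M]_k -> Prop) m n
    (A : set 'rV[M]_m) (B : set 'rV[M]_n) :
  iso_via C A B -> A !=set0 -> B !=set0.
Proof. by move=> [f [[fAB _ _] _]] [x /fAB Bx]; exists (f x). Qed.

Lemma pp_iso_sym m n (A : set 'rV[M]_m) (B : set 'rV[M]_n) :
  pp_iso A B -> pp_iso B A.
Proof. by apply: iso_sym; exact: pp_sub. Qed.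

Lemma pp_iso_trans l m n (A : set 'rV[M]_l) (B : set 'rV[M]_m) (D : set 'rV[M]_n) :
  pp_iso A B -> pp_iso B D -> pp_iso A D.
Proof. by apply: iso_trans; [exact: ppI|exact: pp_sub|exact: pp_ex]. Qed.

Lemma pp_iso_refl n (A : set 'rV[M]_n) : pp A -> pp_iso A A.
Proof. by apply: iso_refl; [exact: ppI|exact: ppT|exact: pp_sub|exact: pp_diag]. Qed.

(* Junk value 0 when A is empty or not a pp-set; choosing P up to pp-isomorphism
   keeps proofs out of the arguments. *)
Definition colour_class n (A : set 'rV[M]_n) : Q :=
  if pselect (exists P : ppset M, pp_iso P A) is left h
  then quot_pi (invariants_rel M) << colour_of (projT1 (cid h)) >> else 0.

Lemma colour_classE (P : ppset M) :
  colour_class P = quot_pi (invariants_rel M) << colour_of P >>.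
Proof.
rewrite /colour_class; case: pselect => [h|[]]; last first.
  by exists P; apply/pp_iso_refl/pp_carP.
by case: (cid h) => P' /= /colour_ofP ->.
Qed.

Lemma colour_class0 n : colour_class (@set0 'rV[M]_n) = 0.
Proof.
rewrite /colour_class; case: pselect => // -[P PA].
by have [] := iso_via_neq0 PA (pp_neq0 P).
Qed.

Lemma colour_class_iso m n (A : set 'rV[M]_m) (B : set 'rV[M]_n) :
  pp_iso A B -> colour_class A = colour_class B.
Proof.
move=> AB; rewrite /colour_class; case: pselect => hA; case: pselect => hB //.
- case: (cid hA) (cid hB) => P PA [P' PB] /=; congr (quot_pi _ << _ >>).
  apply/colour_ofP; apply: pp_iso_trans PA _; apply: pp_iso_trans AB _.
  exact: pp_iso_sym.
- by case: hB; have [P PA] := hA; exists P; apply: pp_iso_trans PA AB.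
- by case: hA; have [P PB] := hB; exists P; apply/(pp_iso_trans PB)/pp_iso_sym.
Qed.

Lemma prod_set0l m n (B : set 'rV[M]_n) : prod_set (@set0 'rV[M]_m) B = set0.
Proof. by apply/seteqP; split=> // z []. Qed.

Lemma prod_set0r m n (A : set 'rV[M]_m) : prod_set A (@set0 'rV[M]_n) = set0.
Proof. by apply/seteqP; split=> // z []. Qed.

Lemma nonempty_neq0 (T : Type) (A : set T) : ~ (A !=set0) -> A = set0.
Proof. by move=> A0; apply/seteqP; split=> // x Ax; apply: A0; exists x. Qed.

Lemma colour_class_prod m n (A : set 'rV[M]_m) (B : set 'rV[M]_n) :
  (0 < m)%N -> (0 < n)%N -> pp A -> pp B ->
  colour_class (prod_set A B) = colour_class A * colour_class B.
Proof.
move=> m0 n0 ppA ppB.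
have [A0|/nonempty_neq0 ->] := pselect (A !=set0); last first.
  by rewrite prod_set0l !colour_class0 mul0r.
have [B0|/nonempty_neq0 ->] := pselect (B !=set0); last first.
  by rewrite prod_set0r !colour_class0 mulr0.
pose PA := PPSet m0 ppA A0; pose PB := PPSet n0 ppB B0.
rewrite (colour_classE PA) (colour_classE PB) (colour_classE (ppset_prod PA PB)).
by rewrite -rmorphM malgM_def fgmulUU mulr1 -[colour_of (ppset_prod _ _)]cmulE.
Qed.

(** This is the hypothesis [mu_transversal] for colours, and the point where the construction of
    [euler] uses the generators of the invariants ideal. *)
Lemma colour_class_transversal n (P N : set 'rV[M]_n) l : (0 < n)%N ->
  pp P -> P !=set0 -> pp N -> subgrp N -> N `<=` direction P ->
  transversal P N l -> colour_class P = colour_class N *+ size l.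
Proof.
move=> n0 ppP P0 ppN sN NP lP; have [p Pp] := P0.
have aP := pp_affine ppP.
(* [N] need not lie in [P], as a generator of the ideal requires; its coset through [p] does, and
   has the same colour. *)
pose B := [set x | N (x - p)].
have ppB : pp B by apply: pp_coset.
have B0 : B !=set0 by exists p; rewrite /B /= subrr; exact: sN.1.
have dB : direction B = N by exact: direction_coset.
have BP : B `<=` P by move=> x /NP; apply: directionE.
have -> : colour_class N = colour_class B.
  apply: colour_class_iso; have := coset_iso 0 p ppN.
  by congr pp_iso; apply/funext => x /=; rewrite subr0.
rewrite (colour_classE (PPSet n0 ppP P0)) (colour_classE (PPSet n0 ppB B0)).
rewrite -raddfMn; apply/quot_piP/mem_ideal_span.
exists n, n0, P, B, ppP, ppB, P0, B0, (size l); split=> //.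
by rewrite /pp_index dB (setIidr NP); apply: card_cosets.
Qed.

(** A presentation is chosen; for definable sets one exists by quantifier elimination, so the empty
    list is only a junk default. *)
Definition euler n (A : set 'rV[M]_n) : Q :=
  valuation (@colour_class n) (xget [::] [set s |
    (forall p, p \in s -> pp p.2) /\ ind A =1 simple s]).

(** Two presentations of one indicator differ by a relation, on which the valuation vanishes. *)
Lemma eulerE n (A : set 'rV[M]_n) s : (0 < n)%N ->
  (forall p, p \in s -> pp p.2) -> ind A =1 simple s ->
  euler A = valuation (@colour_class n) s.
Proof.
move=> n0 sP sE; rewrite /euler; case: xgetP => [t _ [tP tE]|/(_ s)[]//].
set t' := [seq (- p.1, p.2) | p <- t].
have tV : valuation (@colour_class n) t' = - valuation (@colour_class n) t.
  rewrite /valuation big_map -sumrN; apply: eq_bigr => p _.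
  by rewrite mulrNz.
apply/esym/eqP; rewrite -subr_eq0 -tV; apply/eqP.
rewrite /valuation -big_cat.
apply: (@valuation_eq0 R M n Q _ (colour_class0 n)) => [P N l|p|x].
- exact: colour_class_transversal.
- by rewrite mem_cat => /orP[/sP //|/mapP[q /tP qP ->]].
- rewrite simple_cat -sE {1}/t' /simple big_map.
  under eq_bigr do rewrite mulNr.
  by rewrite sumrN -/(simple t x) -tE subrr.
Qed.

Lemma euler_pp n (A : set 'rV[M]_n) : (0 < n)%N -> pp A -> euler A = colour_class A.
Proof.
move=> n0 ppA; rewrite (@eulerE _ _ [:: (1, A)]) //.
- by rewrite /valuation big_seq1.
- by move=> p; rewrite inE => /eqP->.
- by move=> x; rewrite /simple big_seq1 mul1r.
Qed.

Lemma euler_empty n : (0 < n)%N -> euler (@set0 'rV[M]_n) = 0.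
Proof.
move=> n0; rewrite (@eulerE _ _ [::]) //; first by rewrite /valuation big_nil.
by move=> x; rewrite simple_nil ind0.
Qed.

Lemma eulerU n (A B : set 'rV[M]_n) : (0 < n)%N -> definable A -> definable B ->
  A `&` B = set0 -> euler (A `|` B) = euler A + euler B.
Proof.
move=> n0 /pp_simple_definable[s [sP sE]] /pp_simple_definable[t [tP tE]] AB0.
rewrite (eulerE n0 sP sE) (eulerE n0 tP tE) (@eulerE _ _ (s ++ t)) //.
- by rewrite /valuation big_cat.
- by move=> p; rewrite mem_cat => /orP[/sP|/tP].
- by move=> x; rewrite indU // simple_cat sE tE.
Qed.

Lemma ind_prod m n (A : set 'rV[M]_m) (B : set 'rV[M]_n) z :
  ind (prod_set A B) z = ind A (lsubmx z) * ind B (rsubmx z).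
Proof. exact: (indI (fun z => A (lsubmx z)) (fun z => B (rsubmx z))). Qed.

Lemma euler_prod m n (A : set 'rV[M]_m) (B : set 'rV[M]_n) :
  (0 < m)%N -> (0 < n)%N -> definable A -> definable B ->
  euler (prod_set A B) = euler A * euler B.
Proof.
move=> m0 n0 /pp_simple_definable[s [sP sE]] /pp_simple_definable[t [tP tE]].
pose st := [seq (p.1 * q.1, prod_set p.2 q.2) | p <- s, q <- t].
rewrite (eulerE m0 sP sE) (eulerE n0 tP tE) (@eulerE _ _ st).
- rewrite /valuation big_allpairs_dep mulr_suml; apply: eq_big_seq => p /sP pp_p.
  rewrite mulr_sumr; apply: eq_big_seq => q /tP pp_q.
  rewrite colour_class_prod // mulrzAl mulrzAr -mulrzA mulrC.
  by congr (_ *~ _); rewrite mulrC.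
- by rewrite ltn_addr.
- by move=> _ /allpairsP[[p q] [/sP ? /tP ? ->]]; apply: pp_prod.
- move=> z; rewrite ind_prod sE tE /simple big_allpairs_dep mulr_suml.
  apply: eq_bigr => p _; rewrite mulr_sumr; apply: eq_bigr => q _.
  by rewrite ind_prod mulrACA.
Qed.

End ColourValuation.

(** * Invariance under definable bijections *)

Section Invariance.
Variables (R : pzRingType) (M : lmodType R^c) (k n : nat) (s : 'I_k -> 'I_n).
Implicit Types (P Q F : set 'rV[M]_n).

Definition coord_inj F :=
  forall x y, F x -> F y -> coord s x = coord s y -> x = y.

Lemma coord_inj_sub F P : F `<=` P -> coord_inj P -> coord_inj F.
Proof. by move=> FP iP x y /FP Px /FP Py; apply: iP. Qed.

(* Let N be the meet of the directions of P and of the Q of finite index in P.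
   The coset z + N of a point z of the block lies in the block up to finitely
   many cosets of infinite index, so that by Neumann's lemma it contains, for
   each d in N, two points of the block that differ by d; hence the coordinate
   map is injective on N. *)
Lemma block_coord_inj_cover P Qs : pp P -> (forall Q, Q \in Qs -> pp Q) ->
  coord_inj (block P Qs) ->
  exists cs : seq (set 'rV[M]_n), (forall c, c \in cs -> pp c /\ coord_inj c) /\
    forall z, block P Qs z -> exists2 c, c \in cs & c z.
Proof.
move=> ppP ppQs inj.
have [[z0 Bz0]|B0] := pselect (block P Qs !=set0); last first.
  by exists [::]; split=> // z Bz; case: B0; exists z.
have Pz0 := Bz0.1; have aP := pp_affine ppP; have P0 : P !=set0 by exists z0.
have sP := direction_subgrp aP P0.
pose Qf := [seq Q <- Qs | `[< Q !=set0 /\ fin_index (direction P) (direction Q) >]].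
have QfP Q : Q \in P :: Qf ->
    [/\ pp Q, Q !=set0 & fin_index (direction P) (direction Q)].
  rewrite in_cons => /orP[/eqP->|].
    by split=> //; exact: fin_index_refl.
  by rewrite mem_filter => /andP[/asboolP[Q0 fQ] /ppQs].
pose N := direction_meet (P :: Qf).
have sN : subgrp N.
  by apply: direction_meet_subgrp => Q /QfP[/pp_affine].
have ppN : pp N by apply: direction_meet_pp => Q /QfP[].
have fN : fin_index (direction P) N.
  by apply: direction_meet_fin_index => Q /QfP[/pp_affine].
have NP : N `<=` direction P by move=> d; apply; exact: mem_head.
have NQ Q : Q \in Qf -> N `<=` direction Q.
  by move=> QQ d; apply; rewrite in_cons QQ orbT.
have nQf Q x : Q \in Qf -> N (x - z0) -> ~ Q x.
  move=> QQ Nx Qx; have [_ nQ] := Bz0.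
  have QQs : Q \in Qs by move: QQ; rewrite mem_filter => /andP[].
  apply: (nQ Q QQs); apply: (directionE (pp_affine (ppQs Q QQs)) Qx).
  exact: (NQ _ QQ _ (subgrp_subC sN Nx)).
(* If some z0 + h with h in [N] avoids each [Q] outside [Qf] together with its translate Q - d, then
   z0 + h and z0 + h + d are points of the block with equal coordinates, so d = 0. Otherwise these
   sets cover z0 + N. *)
have Nker d : N d -> coord s d = 0 -> d = 0.
  move=> Nd sd; apply: contrapT => d0.
  pose Q's := [seq Q <- Qs | Q \notin Qf].
  have Q'sP Q : Q \in Q's -> [/\ Q \in Qs, Q \notin Qf & affine Q].
    by rewrite mem_filter => /andP[QQ Qin]; split=> //; exact: pp_affine (ppQs Q Qin).
  pose sh Q := [set x : 'rV[M]_n | Q (x + d)].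
  have ash Q : affine Q -> affine (sh Q).
    move=> aQ x y z Qx Qy Qz; have := aQ _ _ _ Qx Qy Qz; rewrite /sh /=.
    by congr Q; zmod.
  have [||F [Fin F0 fF]] := @neumann_cosets _ _ _ N (Q's ++ map sh Q's) z0 sN.
  - move=> Q; rewrite mem_cat => /orP[/Q'sP[]//|/mapP[Q1 /Q'sP[_ _ aQ] ->]].
    exact: ash.
  - move=> h Nh; apply: contrapT => nh; apply: d0.
    have Bh g : N g -> (forall Q, Q \in Q's -> ~ Q (z0 + g)) -> block P Qs (z0 + g).
      move=> Ng nQ; split; first by apply/(directionP _ aP Pz0)/NP.
      move=> Q Qin; have [QQ|QQ] := boolP (Q \in Qf).
        by apply: nQf => //; congr N: Ng; zmod.
      by apply: nQ; rewrite mem_filter QQ.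
    have B1 : block P Qs (z0 + h).
      apply: Bh => // Q Qin Qh; apply: nh; exists Q => //.
      by rewrite mem_cat Qin.
    have B2 : block P Qs (z0 + (h + d)).
      apply: Bh; first exact: (subgrpD sN Nh Nd).
      move=> Q Qin Qh; apply: nh; exists (sh Q); last by rewrite /sh /= -addrA.
      by rewrite mem_cat map_f ?orbT.
    have E : coord s (z0 + (h + d)) = coord s (z0 + h).
      by rewrite addrA [LHS]coordD sd addr0.
    have /(congr1 (fun x => x - (z0 + h))) := inj _ _ B2 B1 E.
    by rewrite subrr => <-; zmod.
  have nf Q : Q \in Q's -> Q !=set0 -> ~ fin_index N (direction Q).
    move=> /Q'sP[Qin /negP + _] Q0 fQ; apply.
    rewrite mem_filter Qin andbT; apply/asboolP; split=> //.
    exact: fin_index_trans fN fQ.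
  move: Fin; rewrite mem_cat => /orP[/nf/(_ F0) //|/mapP[Q Qin EF]].
  have [q Qq] := F0; rewrite EF /sh /= in Qq.
  have [_ _ aQ] := Q'sP _ Qin; have Q0 : Q !=set0 by exists (q + d).
  (* Translating [Q] does not change its direction. *)
  apply: (nf Q Qin Q0); congr (fin_index _ _): fF; apply/funext => t.
  apply/propext; rewrite EF (directionP t aQ Qq) (directionP t (ash _ aQ) Qq) /sh /=.
  by have -> : q + t + d = q + d + t by zmod.
have [l lP] := fin_index_affine aP fN.
exists [seq [set x | N (x - a)] | a <- l]; split=> [_ /mapP[a _ ->]|z [Pz _]].
  split=> [|x y /= Nx Ny sxy]; first exact: pp_coset.
  apply: subr0_eq; apply: Nker; last by rewrite coordB sxy subrr.
  exact: (subgrp_trans sN Nx (subgrp_subC sN Ny)).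
by have [a al Na] := lP z Pz; exists [set x | N (x - a)] => //; apply: map_f.
Qed.

Lemma definable_coord_inj_cover F : definable F -> coord_inj F ->
  exists cs : seq (set 'rV[M]_n), (forall c, c \in cs -> pp c /\ coord_inj c) /\
    forall z, F z -> exists2 c, c \in cs & c z.
Proof.
move=> /pp_simple_definable sF inj.
have [bs [bsP bsE]] := simple_in_blocks (@ppI R M _) (@ppT R M _) [set 1] sF.
have bF b z : b \in bs -> block b.1 b.2 z -> F z.
  move=> bbs Bz; apply: contrapT => nF.
  have /bsE : exists2 b, b \in bs & block b.1 b.2 z by exists b.
  by rewrite /= ind0.
have H b : exists cs : seq (set 'rV[M]_n), b \in bs ->
    (forall c, c \in cs -> pp c /\ coord_inj c) /\
    forall z, block b.1 b.2 z -> exists2 c, c \in cs & c z.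
  have [bbs|] := boolP (b \in bs); last by exists [::].
  have [P1 P2] := bsP b bbs.
  have [|cs csP] := block_coord_inj_cover P1 P2; last by exists cs.
  by apply: coord_inj_sub inj => z; apply: bF.
have [cs csP] := choice H.
exists (flatten [seq cs b | b <- bs]); split.
  by move=> c /flattenP[_ /mapP[b bbs ->]]; exact: (csP b bbs).1.
move=> z Fz; have /bsE[b bbs Bz] : [set 1] (ind F z) by apply: ind1.
have [c ccs cz] := (csP b bbs).2 z Bz; exists c => //.
by apply/flattenP; exists (cs b) => //; apply: map_f.
Qed.

Hypotheses (k_gt0 : (0 < k)%N) (n_gt0 : (0 < n)%N).

Lemma colour_class_coord P : pp P -> coord_inj P ->
  colour_class (coord s @` P) = colour_class P.
Proof.
move=> ppP inj; apply/esym/colour_class_iso.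
apply: (@iso_coord _ _ _ (@ppI R M) (@ppT R M) (@pp_sub R M) (@pp_diag R M) _ _ s) => //.
split=> [x Px|x y|x]; first by exists x.
  by move=> /set_mem Px /set_mem Py; apply: inj.
by move=> [y Py <-]; exists y.
Qed.

(** An injective map commutes with intersections, so a presentation of [F] by pp-subsets of [P] is
    carried to one of the image, with each term replaced by a pp-isomorphic set. *)
Let euler_coord_pp P F : pp P -> coord_inj P -> definable F -> F `<=` P ->
  euler (coord s @` F) = euler F.
Proof.
move=> ppP inj /pp_simple_definable[t [tP tE]] FP.
have indF A z : P z -> A `<=` P -> ind (coord s @` A) (coord s z) = ind A z.
  move=> Pz AP; have [Az|Az] := pselect (A z); first by rewrite !ind1 //; exists z.
  rewrite !ind0 // => -[y Ay e]; apply: Az.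
  by rewrite -(inj _ _ (AP _ Ay) Pz e).
pose u := [seq (p.1, P `&` p.2) | p <- t].
rewrite (@eulerE _ _ n F u) // => [|_ /mapP[p /tP pp_p ->]|z]; first last.
- have -> : ind F z = ind P z * ind F z.
    have [Pz|Pz] := pselect (P z); first by rewrite (ind1 Pz) mul1r.
    by rewrite (ind0 Pz) mul0r ind0 // => /FP.
  rewrite tE /simple big_map mulr_sumr; apply: eq_bigr => p _.
  by rewrite indI mulrCA.
- exact: ppI.
rewrite (@eulerE _ _ k _ [seq (p.1, coord s @` (P `&` p.2)) | p <- t]) //.
- rewrite /valuation !big_map; apply: eq_big_seq => p /tP pp_p /=.
  rewrite colour_class_coord //; first exact: ppI.
  by apply: coord_inj_sub inj => z [].
- by move=> _ /mapP[p /tP pp_p ->]; apply/pp_image_coord/ppI.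
move=> x; rewrite /simple big_map.
have [[z Pz <-]|nP] := pselect ((coord s @` P) x).
  rewrite indF // tE; apply: eq_bigr => p _; rewrite indF; first last.
  - by move=> y [].
  - by [].
  by rewrite indI (ind1 Pz) mul1r.
rewrite ind0 => [|[z Fz e]]; last by apply: nP; exists z => //; apply: FP.
rewrite big1 // => p _; rewrite ind0 ?mulr0 // => -[z [Pz _] e].
by apply: nP; exists z.
Qed.

(** The covering sets may overlap and stick out of [F]; splitting [F] along one of them at a time
    avoids making them disjoint. *)
Lemma euler_coord F : definable F -> coord_inj F ->
  euler (coord s @` F) = euler F.
Proof.
move=> dF iF; have [cs [csP cov]] := definable_coord_inj_cover dF iF.
elim: cs F dF iF csP cov => [|c cs IH] F dF iF csP cov.
  have -> : F = set0 by apply/seteqP; split=> // z /cov[].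
  by rewrite image_set0 !euler_empty.
have [ppc ic] := csP c (mem_head _ _); have dc := pp_definable ppc.
have dFc : definable (F `&` c) by apply: definableI.
have dFD : definable (F `&` ~` c) by apply: definableI => //; apply: definableC.
have EF : F = (F `&` c) `|` (F `&` ~` c) by rewrite -setIUr setUv setIT.
rewrite [in LHS]EF image_setU eulerU //; first last.
- apply/seteqP; split=> // x [[y [Fy cy] <-] [z [Fz cz] e]].
  by case: cz; rewrite (iF _ _ Fz Fy e).
- exact: definable_image_coord.
- exact: definable_image_coord.
rewrite [in RHS]EF eulerU //; last by rewrite setIACA setICr setI0.
congr (_ + _).
  by apply: (euler_coord_pp ppc) => // z [].
apply: IH => //.
- by apply: coord_inj_sub iF => z [].
- by move=> c' c's; apply: csP; rewrite in_cons c's orbT.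
move=> z [Fz cz]; have [c'] := cov z Fz.
by rewrite in_cons => /orP[/eqP-> //|]; exists c'.
Qed.

End Invariance.

Section EulerIso.
Variables (R : pzRingType) (M : lmodType R^c).

(** Both sets are compared with the graph: one projection is injective on it because it is a graph,
    the other because the map is. *)
Lemma euler_iso m n (A : set 'rV[M]_m) (B : set 'rV[M]_n) :
  (0 < m)%N -> (0 < n)%N -> def_iso A B -> euler A = euler B.
Proof.
move=> m0 n0 [f [[fAB inj surj] dG]].
have mn0 : (0 < m + n)%N by rewrite ltn_addr.
have <- : coord (lshift n) @` graph_on A f = A.
  apply/seteqP; split=> [_ [_ [x Ax <-] <-]|x Ax].
    by rewrite coord_lshift row_mxKl.
  by exists (row_mx x (f x)); [exists x|rewrite coord_lshift row_mxKl].
have <- : coord (@rshift m n) @` graph_on A f = B.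
  apply/seteqP; split=> [_ [_ [x Ax <-] <-]|y /surj[x Ax <-]].
    by rewrite coord_rshift row_mxKr; apply: fAB.
  by exists (row_mx x (f x)); [exists x|rewrite coord_rshift row_mxKr].
rewrite !euler_coord //.
  move=> _ _ [x Ax <-] [y Ay <-]; rewrite !coord_rshift !row_mxKr => e.
  by rewrite (inj _ _ (mem_set Ax) (mem_set Ay) e).
by move=> _ _ [x Ax <-] [y Ay <-]; rewrite !coord_lshift !row_mxKl => ->.
Qed.

End EulerIso.

(** * The inverse morphism *)

Section DefinableValuation.
Variables (R : pzRingType) (M : lmodType R^c).

Lemma pp_iso_def m n (A : set 'rV[M]_m) (B : set 'rV[M]_n) :
  pp_iso A B -> def_iso A B.
Proof. by move=> [f [fAB ppG]]; exists f; split=> //; apply: pp_definable. Qed.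

Lemma def_iso_sym m n (A : set 'rV[M]_m) (B : set 'rV[M]_n) :
  def_iso A B -> def_iso B A.
Proof. by apply: iso_sym; exact: definable_sub. Qed.

Lemma def_iso_trans l m n (A : set 'rV[M]_l) (B : set 'rV[M]_m) (D : set 'rV[M]_n) :
  def_iso A B -> def_iso B D -> def_iso A D.
Proof. by apply: iso_trans; [exact: definableI|exact: definable_sub|exact: definable_ex]. Qed.

Lemma def_iso_refl n (A : set 'rV[M]_n) : definable A -> def_iso A A.
Proof.
by apply: iso_refl; [exact: definableI|exact: definableT|exact: definable_sub|
  exact: definable_diag].
Qed.

(** The counterpart of [colour_class], with junk value 0; it is a function of the bare set, so sums
    over presentations need no proofs in their terms. *)
Definition K0_of n (A : set 'rV[M]_n) : K0 M :=
  if pselect (exists D : defset M, def_iso D A) is left h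
  then K0_class (dclass_of (projT1 (cid h))) else 0.

Lemma K0_ofE (D : defset M) : K0_of D = K0_class (dclass_of D).
Proof.
rewrite /K0_of; case: pselect => [h|[]]; last first.
  by exists D; apply/def_iso_refl/def_carP.
by case: (cid h) => D' /= /dclass_ofP ->.
Qed.

Lemma K0_of_iso m n (A : set 'rV[M]_m) (B : set 'rV[M]_n) :
  def_iso A B -> K0_of A = K0_of B.
Proof.
move=> AB; rewrite /K0_of; case: pselect => hA; case: pselect => hB //.
- case: (cid hA) (cid hB) => D DA [D' DB] /=; congr K0_class.
  apply/dclass_ofP; apply: def_iso_trans DA _; apply: def_iso_trans AB _.
  exact: def_iso_sym.
- by case: hB; have [D DA] := hA; exists D; apply: def_iso_trans DA AB.
- by case: hA; have [D DB] := hB; exists D; apply/(def_iso_trans DB)/def_iso_sym.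
Qed.

Lemma K0_of_empty n : (0 < n)%N -> K0_of (@set0 'rV[M]_n) = 0.
Proof.
move=> n0; have [dz _ _ _] := K0_class_morphism M.
rewrite (K0_ofE (DefSet n0 (@definable0 R M n))) -dz; congr K0_class.
by apply/dclass_ofP; apply: iso_empty; exact: definable0.
Qed.

Lemma K0_ofU n (A B : set 'rV[M]_n) : (0 < n)%N -> definable A -> definable B ->
  A `&` B = set0 -> K0_of (A `|` B) = K0_of A + K0_of B.
Proof.
move=> n0 dA dB AB0; have [_ _ dD _] := K0_class_morphism M.
rewrite (K0_ofE (DefSet n0 dA)) (K0_ofE (DefSet n0 dB)).
rewrite (K0_ofE (DefSet n0 (definableU dA dB))); apply: dD.
by exists n, n0, A, B, dA, dB.
Qed.

Lemma K0_of_split n (A B : set 'rV[M]_n) : (0 < n)%N -> definable A ->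
  definable B -> K0_of A = K0_of (A `&` B) + K0_of (A `&` ~` B).
Proof.
move=> n0 dA dB; rewrite -K0_ofU //; first by rewrite -setIUr setUv setIT.
- exact: definableI.
- by apply: definableI => //; apply: definableC.
- by rewrite setIACA setICr setI0.
Qed.

Lemma K0_of_prod m n (A : set 'rV[M]_m) (B : set 'rV[M]_n) :
  (0 < m)%N -> (0 < n)%N -> definable A -> definable B ->
  K0_of (prod_set A B) = K0_of A * K0_of B.
Proof.
move=> m0 n0 dA dB; have [_ _ _ dM] := K0_class_morphism M.
rewrite (K0_ofE (DefSet m0 dA)) (K0_ofE (DefSet n0 dB)) -dM dmulE.
exact: (K0_ofE (def_prod (DefSet m0 dA) (DefSet n0 dB))).
Qed.

Lemma definable_coset n (N : set 'rV[M]_n) a : pp N -> definable [set x | N (x - a)].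
Proof. by move=> ppN; apply/pp_definable/pp_coset. Qed.

Lemma K0_of_cosets n (N : set 'rV[M]_n) l : (0 < n)%N -> pp N -> subgrp N ->
  uniq l -> (forall a b, a \in l -> b \in l -> N (a - b) -> a = b) ->
  definable [set x | exists2 a, a \in l & N (x - a)] /\
  K0_of [set x | exists2 a, a \in l & N (x - a)] = K0_of N *+ size l.
Proof.
move=> n0 ppN sN; elim: l => [|a l IH] /= => [_ _|/andP[al ul] lsep].
  have -> : [set x | exists2 a, a \in [::] & N (x - a)] = set0.
    by apply/seteqP; split=> // x [].
  by split; [exact: definable0|exact: K0_of_empty].
have [|dl El] := IH ul.
  by move=> b c bl cl; apply: lsep; rewrite in_cons ?bl ?cl orbT.
set B := [set x | _] in dl El.
have -> : [set x | exists2 b, b \in a :: l & N (x - b)] = [set x | N (x - a)] `|` B.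
  apply/seteqP; split=> x /=.
    by move=> [b]; rewrite in_cons => /orP[/eqP->|bl] Nb; [left|right; exists b].
  move=> [Na|[b bl Nb]]; first by exists a; rewrite ?mem_head.
  by exists b; rewrite // in_cons bl orbT.
have dC := definable_coset a ppN.
split; first exact: definableU.
rewrite K0_ofU // ?El ?mulrS; last first.
  apply/seteqP; split=> // x [/= Na [b bl Nb]].
  have /lsep : N (a - b) by exact: (subgrp_trans sN (subgrp_subC sN Na) Nb).
  rewrite mem_head in_cons bl orbT => /(_ isT isT) ab.
  by rewrite ab bl in al.
congr (_ + _); apply/K0_of_iso/pp_iso_def; have := coset_iso a 0 ppN.
by congr pp_iso; apply/funext => x /=; rewrite subr0.
Qed.

Lemma K0_of_transversal n (P N : set 'rV[M]_n) l : (0 < n)%N ->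
  affine P -> pp N -> subgrp N -> N `<=` direction P ->
  transversal P N l -> K0_of P = K0_of N *+ size l.
Proof.
move=> n0 aP ppN sN NP [ul lP lcov lsep].
have [_ <-] := K0_of_cosets n0 ppN sN ul lsep; congr K0_of.
apply/seteqP; split=> [x /lcov//|x [a /lP Pa Na]].
by apply: (directionE aP Pa); apply: NP.
Qed.

(** This makes the generators of the invariants ideal vanish in [K0 M]. *)
Lemma K0_of_index n (P Q : set 'rV[M]_n) k : (0 < n)%N -> pp P -> P !=set0 ->
  pp Q -> Q !=set0 -> Q `<=` P -> pp_index P Q k -> K0_of P = K0_of Q *+ k.
Proof.
move=> n0 ppP P0 ppQ Q0 QP PQk.
have aP := pp_affine ppP; have aQ := pp_affine ppQ.
have [l [lP <-]] := pp_index_transversal aP P0 aQ Q0 QP PQk.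
have sN := direction_subgrp aQ Q0; have ppN := pp_direction ppQ Q0.
rewrite (K0_of_transversal n0 aP ppN sN (direction_sub aP Q0 aQ QP) lP).
congr (_ *+ _); apply: K0_of_iso; apply: pp_iso_def.
have [q Qq] := Q0; have := coset_iso 0 q ppN; congr pp_iso.
  by apply/funext => x /=; rewrite subr0.
apply/funext => x /=; apply/propext; split; first exact: directionE.
by move=> Qx; apply: directionB.
Qed.

(* Induction on s, splitting E along the first set of s. *)
Lemma K0_of_simple_eq0 n (E : set 'rV[M]_n) c s : (0 < n)%N -> definable E ->
  (forall p, p \in s -> definable p.2) -> (forall x, E x -> c + simple s x = 0) ->
  K0_of E *~ c + \sum_(p <- s) K0_of (E `&` p.2) *~ p.1 = 0.
Proof.
move=> n0; elim: s E c => [|p s IH] E c dE ds Es.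
  rewrite big_nil addr0; have [[x Ex]|/nonempty_neq0 ->] := pselect (E !=set0).
    by have := Es x Ex; rewrite simple_nil addr0 => ->.
  by rewrite K0_of_empty // mul0rz.
have dp : definable p.2 by apply: ds; rewrite mem_head.
have ds' q : q \in s -> definable q.2 by move=> qs; apply: ds; rewrite in_cons qs orbT.
(* On the part inside [p.2] the coefficient of [p] joins the constant [c]. *)
have := IH (E `&` p.2) (c + p.1) (definableI dE dp) ds'.
have := IH (E `&` ~` p.2) c (definableI dE (definableC dp)) ds'.
move=> H2 H1; rewrite big_cons (K0_of_split n0 dE dp).
have -> : \sum_(q <- s) K0_of (E `&` q.2) *~ q.1 =
    \sum_(q <- s) K0_of (E `&` p.2 `&` q.2) *~ q.1 +
    \sum_(q <- s) K0_of (E `&` ~` p.2 `&` q.2) *~ q.1.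
  rewrite -big_split; apply: eq_big_seq => q qs /=.
  rewrite (K0_of_split n0 (definableI dE (ds' q qs)) dp) mulrzDl.
  by rewrite [E `&` q.2 `&` p.2]setIAC [E `&` q.2 `&` _]setIAC.
move: H1 H2; set a := K0_of (E `&` p.2); set b := K0_of (E `&` ~` p.2).
set S1 := \sum_(q <- s) _; set S2 := \sum_(q <- s) _ => H1 H2.
transitivity ((a *~ (c + p.1) + S1) + (b *~ c + S2)).
  by rewrite mulrzDl mulrzDr; zmod.
rewrite H1 ?H2 ?addr0 // => x [Ex px].
  by have := Es x Ex; rewrite simple_cons ind0 // mulr0 add0r.
by have := Es x Ex; rewrite simple_cons ind1 // mulr1 addrA.
Qed.

(** All intersections and differences of definable sets have classes here, so linearity follows by
    cutting up, without Neumann's lemma. *)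
Lemma K0_of_simple n (A : set 'rV[M]_n) s : (0 < n)%N -> definable A ->
  (forall p, p \in s -> definable p.2) -> ind A =1 simple s ->
  K0_of A = valuation (@K0_of n) s.
Proof.
move=> n0 dA ds sE.
(* The presentation is read as a relation on the whole space, with [A] as an extra term of
   coefficient -1. *)
have := @K0_of_simple_eq0 n setT 0 ((- 1, A) :: s) n0 (@definableT R M n).
rewrite mulr0z add0r big_cons setTI mulrN1z => H.
apply/eqP; rewrite -subr_eq0 -oppr_eq0 opprB addrC; apply/eqP; rewrite -[RHS]H.
- by congr (_ + _); apply: eq_bigr => p _; rewrite setTI.
- by move=> p; rewrite in_cons => /orP[/eqP->|/ds].
- by move=> x _; rewrite simple_cons sE mulN1r add0r addNr.
Qed.

End DefinableValuation.

(** * Extension of maps to monoid rings and quotient rings *)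

Section Lifts.

Lemma malg_ext (K : choiceType) (S : zmodType) (f g : {additive {malg int[K]} -> S}) :
  (forall k, f << k >> = g << k >>) -> f =1 g.
Proof.
move=> fg a; rewrite (monalgE a) !raddf_sum; apply: eq_bigr => k _.
have -> : << a@_k *g k >> = << k >> *~ a@_k :> {malg int[K]}.
  by rewrite -raddfMz intz.
by rewrite !raddfMz fg.
Qed.

(* The library's mmap only covers nontrivial target rings. *)
Lemma malg_lift (K : conomType) (S : comPzRingType) (f : K -> S) :
  f mone = 1 -> (forall k l, f (mmul k l) = f k * f l) ->
  exists h : {rmorphism {malg int[K]} -> S}, forall k, h << k >> = f k.
Proof.
move=> f1 fM; pose h (z : {malg int[K]}) : S := \sum_(k <- msupp z) f k *~ z@_k.
have hE (d : {fset K}) z : (msupp z `<=` d)%fset -> h z = \sum_(k <- d) f k *~ z@_k.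
  move=> zd; rewrite /h (big_fset_incl _ zd) // => k _ kz.
  by rewrite mcoeff_outdom.
have hB : zmod_morphism h.
  move=> x y; pose d := (msupp x `|` msupp y)%fset.
  rewrite (hE d x) ?fsubsetUl // (hE d y) ?fsubsetUr // (hE d) ?msuppB_le //.
  by rewrite -sumrB; apply: eq_bigr => k _; rewrite mcoeffB mulrzBr.
pose hA := GRing.isZmodMorphism.Build _ _ h hB.
pose h' : {additive {malg int[K]} -> S} := HB.pack h hA.
have hU c k : h << c *g k >> = f k *~ c.
  by rewrite (hE [fset k]%fset) ?msuppU_le // big_seq_fset1 mcoeffUU.
have hM : monoid_morphism h.
  split=> [|x y]; first by rewrite -f1 -[RHS]mulr1z -hU.
  rewrite (monalgE x) (monalgE y) mulr_suml -[h]/(h' : _ -> _) !raddf_sum mulr_suml.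
  apply: eq_bigr => k _; rewrite mulr_sumr raddf_sum mulr_sumr.
  apply: eq_bigr => l _; rewrite malgM_def fgmulUU /= !hU fM.
  by rewrite mulrzAl mulrzAr -mulrzA (mulrC y@_l).
pose hR := GRing.isMonoidMorphism.Build _ _ h hM.
by exists (HB.pack h hA hR : {rmorphism {malg int[K]} -> S}) => k; apply: hU.
Qed.

Lemma quot_lift (A S : comPzRingType) (G : set A) (h : {rmorphism A -> S}) :
  (forall x, G x -> h x = 0) ->
  exists g : {rmorphism quot_span G -> S}, forall a, g (quot_pi G a) = h a.
Proof.
move=> hG.
have hI x : ideal_span G x -> h x = 0.
  move=> [s [sG ->]]; rewrite rmorph_sum big1_seq // => p /andP[_ /sG Gp].
  by rewrite rmorphM (hG _ Gp) mulr0.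
have hP z : exists y : S, forall a, quot_pi G a = z -> h a = y.
  have [a <-] := quot_pi_surj z; exists (h a) => b /quot_piP /hI.
  by rewrite rmorphB => /subr0_eq.
have [g gE] := choice hP.
have gh a : g (quot_pi G a) = h a by apply/esym/gE.
have gB : zmod_morphism (g : quot_span G -> S).
  move=> x y; have [[a <-] [b <-]] := (quot_pi_surj x, quot_pi_surj y).
  by rewrite -raddfB !gh rmorphB.
have gM : monoid_morphism (g : quot_span G -> S).
  split=> [|x y]; first by rewrite -(rmorph1 (quot_pi G)) gh rmorph1.
  have [[a <-] [b <-]] := (quot_pi_surj x, quot_pi_surj y).
  by rewrite -rmorphM !gh rmorphM.
pose gA := GRing.isZmodMorphism.Build (quot_span G) S g gB.
pose gR := GRing.isMonoidMorphism.Build (quot_span G) S g gM.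
by exists (HB.pack g gA gR : {rmorphism quot_span G -> S}).
Qed.

End Lifts.

(** * The two mutually inverse morphisms *)

Section Isomorphism.
Variables (R : pzRingType) (M : lmodType R^c).
Local Notation Q := (colour_ring_mod_invariants M).

Lemma euler_lift : exists h : {rmorphism K0 M -> Q},
  forall A : defset M, h (K0_class (dclass_of A)) = euler A.
Proof.
pose f (a : defclass M) : Q := euler (repr a).
have fE (A : defset M) : f (dclass_of A) = euler A.
  apply: euler_iso; rewrite ?def_dim_gt0 //.
  by apply/dclass_ofP; exact: reprK.
have [|h [hE _]] := @K0_universal R M Q f; last by exists h => A; rewrite hE.
split.
- by rewrite fE euler_empty.
- rewrite fE euler_pp //=; last exact: pp1.
  exact: (colour_classE (PPSet (ltn0Sn 0) (pp1 (0 : 'rV[M]_1)) (set1_neq0 0))).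
- by move=> _ _ _ [n [n0 [A [B [dA [dB [AB0 -> -> ->]]]]]]]; rewrite !fE /= eulerU.
- move=> a b; have [[A <-] [B <-]] := (dclass_surj a, dclass_surj b).
  rewrite dmulE !fE /= euler_prod //; by [exact: def_dim_gt0|exact: def_carP].
Qed.

Lemma K0_of_lift : exists g : {rmorphism Q -> K0 M},
  forall P : ppset M, g (quot_pi (invariants_rel M) << colour_of P >>) = K0_of P.
Proof.
pose f (a : colour M) : K0 M := K0_of (repr a).
have fE (P : ppset M) : f (colour_of P) = K0_of P.
  by apply/K0_of_iso/pp_iso_def/colour_ofP; exact: reprK.
have [||h hE] := @malg_lift (colour M) (K0 M) f.
- rewrite [LHS]fE.
  exact: (K0_ofE (DefSet (ltn0Sn 0) (definable1 (0 : 'rV[M]_1)))).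
- move=> a b; have [[A <-] [B <-]] := (colour_surj a, colour_surj b).
  rewrite [mmul _ _]cmulE !fE; apply: K0_of_prod;
    by [exact: pp_dim_gt0|apply/pp_definable/pp_carP].
have [|g gE] := @quot_lift _ (K0 M) (invariants_rel M) h.
  move=> _ [n [n0 [P [B [ppP [ppB [P0 [B0 [k [BP PBk ->]]]]]]]]]].
  rewrite rmorphB rmorphMn !hE !fE /= (K0_of_index n0 ppP P0 ppB B0 BP PBk).
  by rewrite subrr.
by exists g => P; rewrite gE hE fE.
Qed.

End Isomorphism.

Theorem theorem5p2p3 (R : pzRingType) (M : lmodType R^c) :
  exists f : {rmorphism K0 M -> colour_ring_mod_invariants M}, bijective f.
Proof.
have [[h hE] [g gE]] := (euler_lift M, K0_of_lift M).
exists h; exists g => [x|x].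
  have g_class n (A : set 'rV[M]_n) : (0 < n)%N -> pp A -> g (colour_class A) = K0_of A.
    move=> n0 ppA; have [A0|/nonempty_neq0 ->] := pselect (A !=set0).
      by rewrite (colour_classE (PPSet n0 ppA A0)) gE.
    by rewrite colour_class0 raddf0 K0_of_empty.
  (* One pp-presentation of [A] computes both sides, term by term. *)
  have g_euler (A : defset M) : g (euler A) = K0_of A.
    have n0 := def_dim_gt0 A; have dA := def_carP A.
    have [s [sP sE]] := pp_simple_definable dA.
    rewrite (eulerE n0 sP sE) (K0_of_simple n0 dA _ sE); last first.
      by move=> p /sP /pp_definable.
    rewrite /valuation raddf_sum; apply: eq_big_seq => p /sP pp_p.
    by rewrite raddfMz; congr (_ *~ _); apply: g_class => //; exact: def_dim_gt0.
  (* The composite and the identity agree on classes of definable sets, so the uniqueness in the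
     universal property identifies them. *)
  have [h0 [_ h0U]] := K0_universal (K0_class_morphism M).
  rewrite -[RHS]/(idfun x) -[LHS]/((g \o h) x).
  rewrite (h0U (g \o h : {rmorphism _ -> _})) => [|a /=].
    by rewrite (h0U (idfun : {rmorphism _ -> _})).
  by have [A <-] := dclass_surj a; rewrite hE g_euler K0_ofE.
have [a <-] := quot_pi_surj x.
pose q : {additive _ -> _} := quot_pi (invariants_rel M).
(* Additive maps on the monoid ring are determined by the basis of colours, where a pp-set is its
   own presentation. *)
apply: (@malg_ext _ _ (h \o (g \o q)) q) => k /=.
have [P <-] := colour_surj k.
rewrite gE -[K0_of _]/(K0_of (DefSet (pp_dim_gt0 P) (pp_definable (pp_carP P)))).
rewrite K0_ofE hE /= euler_pp ?colour_classE //; first exact: pp_dim_gt0.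
exact: pp_carP.
Qed.
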